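(* Let $X_1,\dots,X_d$ be $\sigma$-finite measure spaces, $f\in L^2(X_1\times\dots\times X_d)$, $r\in\mathbb{N}$, and $\mu_1,\dots,\mu_d\in[0,1]$. If $$\prod_{k=1}^d\mu_k<\frac{1}{r-1}$$ (interpreted as no restriction when $r=1$), or equivalently $\prod_{k=1}^d(1+\omega_k)>r-1$ with $\omega_k=(1-\mu_k)/\mu_k$, then the infimum $$\eta=\inf\Big\{\Big\lVert f-\sum_{p=1}^r\lambda_p\,\varphi_{1p}\otimes\dots\otimes\varphi_{dp}\Big\rVert:\ \boldsymbol\lambda\in\mathbb{C}^r,\ \varphi_{kp}\in L^2(X_k),\ \lVert\varphi_{kp}\rVert=1,\ \mu(\varphi_{k1},\dots,\varphi_{kr})\le\mu_k\ \text{for } k=1,\dots,d\Big\}$$ is attained.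
   Context: $\varphi_1\otimes\dots\otimes\varphi_d$ denotes the function $(\mathbf{x}_1,\dots,\mathbf{x}_d)\mapsto\prod_k\varphi_k(\mathbf{x}_k)$; norms are $L^2$ norms. For unit vectors $\varphi_1,\dots,\varphi_r$ in a Hilbert space, the coherence is $\mu(\varphi_1,\dots,\varphi_r)=\max_{p\ne q}\lvert\langle\varphi_p,\varphi_q\rangle\rvert$. The relative incoherence is $\omega=(1-\mu)/\mu\in[0,\infty]$ (with $\omega=\infty$ when $\mu=0$); the constraint $\mu(\varphi_{k1},\dots,\varphi_{kr})\le\mu_k$ is the same as $\omega(\varphi_{k1},\dots,\varphi_{kr})\ge\omega_k$.
   Formalization: The formal theorem additionally assumes that at least one admissible choice of λ and φ_kp exists (otherwise the infimum is over the empty set and cannot be attained), and it omits the equivalent form of the condition in terms of ω_k. *)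

(* Defs.v *)
(* mathcomp-analysis (measure theory, Lebesgue integral)
   + real_closed's complex numbers R[i]. *)
From HB Require Import structures.
From mathcomp Require Import all_boot all_order all_algebra.
From mathcomp.real_closed Require Import complex.
From mathcomp Require Import all_classical all_reals all_analysis.

Set Implicit Arguments.
Unset Strict Implicit.
Unset Printing Implicit Defensive.

Import Order.TTheory GRing.Theory Num.Theory.
Local Open Scope classical_set_scope.
Local Open Scope ring_scope.

(* Complex-valued functions on a measure space: measurability, L^2,   *)
(* L^2 norm, L^2 inner product, coherence.                             *)
Section L2defs.
Context {R : realType}.
Local Open Scope complex_scope.

(* |z|^2 for z in C = R[i] *)
Definition csq (z : R[i]) : R := complex.Re z ^+ 2 + complex.Im z ^+ 2.

(* |z| *)
Definition cabs (z : R[i]) : R := Num.sqrt (csq z).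

Context {dT : measure_display} {T : measurableType dT}.

(* a complex function is measurable iff its real and imaginary parts are *)
Definition cmeasurable (g : T -> R[i]) : Prop :=
  measurable_fun setT (fun x => complex.Re (g x)) /\
  measurable_fun setT (fun x => complex.Im (g x)).

(* g belongs to L^2(mu) *)
Definition L2 (mu : {measure set T -> \bar R}) (g : T -> R[i]) : Prop :=
  cmeasurable g /\ (\int[mu]_x (csq (g x))%:E < +oo)%E.

(* the L^2 norm ||g|| = (int |g|^2)^(1/2) *)
Definition L2norm (mu : {measure set T -> \bar R}) (g : T -> R[i]) : R :=
  Num.sqrt (fine (\int[mu]_x (csq (g x))%:E)).

(* the L^2 inner product <g, h> = int g * conj h *)
Definition cinner (mu : {measure set T -> \bar R}) (g h : T -> R[i]) : R[i] :=
  (\int[mu]_x complex.Re (g x * (h x)^*)) +i* (\int[mu]_x complex.Im (g x * (h x)^*)).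

(* coherence mu(phi_1,...,phi_r) = max_{p <> q} |<phi_p, phi_q>|
   (the empty max, r <= 1, is 0) *)
Definition coherence (mu : {measure set T -> \bar R}) (r : nat)
    (phi : 'I_r -> T -> R[i]) : R :=
  \big[Num.max/0]_(p < r) \big[Num.max/0]_(q < r | p != q)
     cabs (cinner mu (phi p) (phi q)).

End L2defs.

(* The product X_1 x ... x X_d with the product sigma-algebra          *)
(* (generated by measurable rectangles) and product measures.          *)
Section Product.
Context {d : nat} {disp : 'I_d -> measure_display}
        (T : forall k : 'I_d, measurableType (disp k)).

Definition piT := forall k : 'I_d, T k.

HB.instance Definition _ := gen_eqMixin piT.
HB.instance Definition _ := gen_choiceMixin piT.
HB.instance Definition _ := isPointed.Build piT (fun k => point).

(* the rectangle B_1 x ... x B_d *)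
Definition rect (B : forall k, set (T k)) : set piT :=
  [set x | forall k, B k (x k)].

(* measurable rectangles *)
Definition mrects : set (set piT) :=
  [set A | exists2 B : forall k, set (T k),
             (forall k, measurable (B k)) & A = rect B].

(* X_1 x ... x X_d with the product sigma-algebra *)
Definition prodT := g_sigma_algebraType mrects.

(* P is a product measure of mu_1, ..., mu_d: it gives every measurable
   rectangle the product of the measures of its sides.  For sigma-finite
   factors such a measure exists and is unique. *)
Definition is_product_measure {R : realType}
    (mu : forall k, {measure set (T k) -> \bar R})
    (P : {measure set prodT -> \bar R}) : Prop :=
  forall B : forall k, set (T k), (forall k, measurable (B k)) ->
    P (rect B) = (\big[*%E/1%E]_(k < d) mu k (B k))%E.

Context {R : realType}.
Local Open Scope complex_scope.

(* sum_{p=1}^r lambda_p phi_{1p} (x) ... (x) phi_{dp} *)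
Definition tensor_sum (r : nat) (lam : 'I_r -> R[i])
    (phi : forall k, 'I_r -> T k -> R[i]) : prodT -> R[i] :=
  fun x => \sum_(p < r) lam p * \prod_(k < d) phi k p (x k).

(* admissible parameters: lambda arbitrary in C^r, phi_{kp} in L^2(X_k)
   of norm 1, and coherence(phi_{k1},...,phi_{kr}) <= mu_k *)
Definition admissible (mu : forall k, {measure set (T k) -> \bar R})
    (muk : 'I_d -> R) (r : nat) (lam : 'I_r -> R[i])
    (phi : forall k, 'I_r -> T k -> R[i]) : Prop :=
  forall k, (forall p, L2 (mu k) (phi k p) /\ L2norm (mu k) (phi k p) = 1)
            /\ coherence (mu k) (phi k) <= muk k.

(* the set of approximation errors whose infimum is eta *)
Definition errors (mu : forall k, {measure set (T k) -> \bar R})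
    (P : {measure set prodT -> \bar R}) (f : prodT -> R[i])
    (muk : 'I_d -> R) (r : nat) : set R :=
  [set e | exists (lam : 'I_r -> R[i]) (phi : forall k, 'I_r -> T k -> R[i]), admissible mu muk lam phi /\
       e = L2norm P (fun x => f x - tensor_sum lam phi x)].

End Product.

(* Main.v *)
(* Take a minimizing sequence lambda^n, phi^n and limits along an ultrafilter U.
   Expanding the square of the norm of sum_p lambda_p phi_1p (x) ... (x) phi_dp,
   the coherence bounds give
     (1 - (r - 1) prod_k mu_k) sum_p |lambda_p|^2 <= |sum_p lambda_p phi_1p (x) ...|^2,
   so lambda^n is bounded and has a limit lambda.  The Gram matrices of
   phi^n_k1, ..., phi^n_kr converge to some G_k, which inherits the unit diagonal and
   the coherence bound, and the phi^n_kp converge weakly to some psi_kp.  The error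
   depends on phi only through the Gram matrices and the numbers
   <f, phi_1p (x) ... (x) phi_dp>, which converge to <f, psi_1p (x) ... (x) psi_dp>.

   The Gram matrix of psi_k1, ..., psi_kr may be smaller than G_k.  This is repaired one
   factor k at a time: the other factors being fixed, f is seen by the k-th factor only
   through r vectors b_p of L^2(X_k).  In a finite-dimensional L^2(X_k) weak convergence
   is strong and nothing is lost; otherwise one adds to psi_kp vectors orthogonal to all
   b_q and psi_kq whose Gram matrix is the positive semidefinite defect.  The resulting
   phi has Gram matrices G_k and the same numbers <f, phi_1p (x) ... (x) phi_dp> as psi,
   so it attains the infimum. *)
Require Import Defs.
From HB Require Import structures.
From mathcomp Require Import all_boot all_order all_algebra ring lra.
From mathcomp.real_closed Require Import complex.
From mathcomp Require Import all_classical all_reals all_analysis.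
From mathcomp Require Import measurable_realfun.

Set Implicit Arguments.
Unset Strict Implicit.
Unset Printing Implicit Defensive.

Import Order.TTheory GRing.Theory Num.Theory.
Import numFieldNormedType.Exports.
Local Open Scope classical_set_scope.
Local Open Scope ring_scope.

Local Notation Re := complex.Re.
Local Notation Im := complex.Im.

(* [mathcomp_extra] exports another function of this name. *)
Local Notation dfwith := eqtype.dfwith.

(** * Complex numbers *)

Section ComplexParts.
Context {R : realType}.
Implicit Types (z w : R[i]) (x : R).

Lemma cReD z w : Re (z + w) = Re z + Re w. Proof. by case: z w => [? ?] []. Qed.
Lemma cImD z w : Im (z + w) = Im z + Im w. Proof. by case: z w => [? ?] []. Qed.
Lemma cReN z : Re (- z) = - Re z. Proof. by case: z. Qed.
Lemma cImN z : Im (- z) = - Im z. Proof. by case: z. Qed.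
Lemma cReM z w : Re (z * w) = Re z * Re w - Im z * Im w.
Proof. by case: z w => [? ?] []. Qed.
Lemma cImM z w : Im (z * w) = Re z * Im w + Im z * Re w.
Proof. by case: z w => [? ?] [? ?] /=. Qed.
Lemma cReJ z : Re z^*%C = Re z. Proof. by case: z. Qed.
Lemma cImJ z : Im z^*%C = - Im z. Proof. by case: z. Qed.
Definition partE := (cReD, cImD, cReN, cImN, cReM, cImM, cReJ, cImJ).

Lemma complexP z w : Re z = Re w -> Im z = Im w -> z = w.
Proof. by case: z w => [? ?] [? ?] /= -> ->. Qed.

Lemma cRe_sum I (s : seq I) (P : pred I) (F : I -> R[i]) :
  Re (\sum_(i <- s | P i) F i) = \sum_(i <- s | P i) Re (F i).
Proof. exact: (big_morph _ cReD (erefl _)). Qed.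

Lemma csq_ge0 z : 0 <= csq z.
Proof. by rewrite addr_ge0 ?sqr_ge0. Qed.

Lemma csqM z w : csq (z * w) = csq z * csq w.
Proof. rewrite /csq !partE; ring. Qed.

Lemma conjcM z w : (z * w)^*%C = z^*%C * w^*%C.
Proof. exact: rmorphM. Qed.

Lemma csqJ z : csq z^*%C = csq z.
Proof. by rewrite /csq !partE sqrrN. Qed.

Lemma csqN z : csq (- z) = csq z.
Proof. by rewrite /csq !partE !sqrrN. Qed.

Lemma csq_real x : csq x%:C%C = x ^+ 2.
Proof. by rewrite /csq /= expr0n addr0. Qed.

Lemma mulcJ z : z * z^*%C = (csq z)%:C%C.
Proof. by apply: complexP; rewrite !partE /csq /=; ring. Qed.

Lemma csq_eq0 z : csq z = 0 -> z = 0.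
Proof.
move=> /eqP; rewrite paddr_eq0 ?sqr_ge0// !sqrf_eq0 => /andP[/eqP a /eqP b].
exact: complexP.
Qed.

Lemma csqD_le z w : csq (z + w) <= 2 * csq z + 2 * csq w.
Proof.
rewrite /csq !partE.
have := sqr_ge0 (Re z - Re w); have := sqr_ge0 (Im z - Im w).
by rewrite !expr2; nra.
Qed.

Lemma cabs_ge0 z : 0 <= cabs z. Proof. exact: sqrtr_ge0. Qed.

Lemma cabsM z w : cabs (z * w) = cabs z * cabs w.
Proof. by rewrite /cabs csqM sqrtrM ?csq_ge0. Qed.

Lemma cabs_prod (I : finType) (F : I -> R[i]) :
  cabs (\prod_i F i) = \prod_i cabs (F i).
Proof.
apply: (big_morph _ cabsM).
by rewrite /cabs /csq/= expr1n expr0n addr0 sqrtr1.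
Qed.

Lemma cabsJ z : cabs z^*%C = cabs z.
Proof. by rewrite /cabs csqJ. Qed.

Lemma sqr_cabs z : cabs z ^+ 2 = csq z.
Proof. by rewrite sqr_sqrtr ?csq_ge0. Qed.

Lemma normRe_le z : `|Re z| <= cabs z.
Proof.
rewrite -(@ler_pXn2r _ 2) ?nnegrE ?cabs_ge0// sqr_cabs real_normK ?num_real//.
by rewrite lerDl sqr_ge0.
Qed.

Lemma normIm_le z : `|Im z| <= cabs z.
Proof.
rewrite -(@ler_pXn2r _ 2) ?nnegrE ?cabs_ge0// sqr_cabs real_normK ?num_real//.
by rewrite lerDr sqr_ge0.
Qed.

End ComplexParts.

(** * Limits of complex-valued functions along a filter *)

Section ComplexLimits.
Context {R : realType} {T : Type} (F : set_system T) {FF : ProperFilter F}.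
Implicit Types (u v : T -> R[i]).

(** Convergence is taken on real and imaginary parts, matching [cmeasurable]; each rule below thus
    reduces to real limits. *)
Definition cvgC u (l : R[i]) :=
  (Re (u n) @[n --> F] --> Re l) /\ (Im (u n) @[n --> F] --> Im l).

Lemma cvgC_cst l : cvgC (fun=> l) l.
Proof. by split; apply: cvg_cst. Qed.

Lemma cvgCD u v l m : cvgC u l -> cvgC v m -> cvgC (fun n => u n + v n) (l + m).
Proof.
move=> [a b] [c d]; split; rewrite !partE; under eq_fun do rewrite !partE;
by apply: cvgD.
Qed.

Lemma cvgCN u l : cvgC u l -> cvgC (fun n => - u n) (- l).
Proof.
move=> [a b]; split; rewrite !partE; under eq_fun do rewrite !partE;
by apply: cvgN.
Qed.

Lemma cvgCB u v l m : cvgC u l -> cvgC v m -> cvgC (fun n => u n - v n) (l - m).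
Proof. by move=> a b; apply: cvgCD => //; exact: cvgCN. Qed.

Lemma cvgCJ u l : cvgC u l -> cvgC (fun n => (u n)^*%C) (l^*%C).
Proof.
move=> [a b]; split; rewrite !partE; under eq_fun do rewrite !partE.
  exact: a.
exact: (cvgN b).
Qed.

Lemma cvgCM u v l m : cvgC u l -> cvgC v m -> cvgC (fun n => u n * v n) (l * m).
Proof.
move=> [a b] [c d]; split; rewrite !partE; under eq_fun do rewrite !partE;
[exact: (cvgB (cvgM a c) (cvgM b d))|exact: (cvgD (cvgM a d) (cvgM b c))].
Qed.

Lemma cvgC_big (op : R[i] -> R[i] -> R[i]) idx :
  (forall u v l m, cvgC u l -> cvgC v m -> cvgC (fun n => op (u n) (v n)) (op l m)) ->
  forall (I : Type) (s : seq I) (u : I -> T -> R[i]) (l : I -> R[i]),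
  (forall i, cvgC (u i) (l i)) ->
  cvgC (fun n => \big[op/idx]_(i <- s) u i n) (\big[op/idx]_(i <- s) l i).
Proof.
move=> opP I s u l ul; elim: s => [|i s IH].
  by rewrite big_nil; under eq_fun do rewrite big_nil; exact: cvgC_cst.
by rewrite big_cons; under eq_fun do rewrite big_cons; apply: opP.
Qed.

Lemma cvgC_sum (I : finType) (u : I -> T -> R[i]) (l : I -> R[i]) :
  (forall i, cvgC (u i) (l i)) -> cvgC (fun n => \sum_i u i n) (\sum_i l i).
Proof. by apply: cvgC_big => *; exact: cvgCD. Qed.

Lemma cvgC_prod (I : finType) (u : I -> T -> R[i]) (l : I -> R[i]) :
  (forall i, cvgC (u i) (l i)) -> cvgC (fun n => \prod_i u i n) (\prod_i l i).
Proof. by apply: cvgC_big => *; exact: cvgCM. Qed.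

Lemma cvgC_unique u l m : cvgC u l -> cvgC u m -> l = m.
Proof.
move=> [a b] [c d]; apply: complexP.
- exact: (cvg_unique _ a c).
- exact: (cvg_unique _ b d).
Qed.

Lemma cvgC_csq u l : cvgC u l -> csq (u n) @[n --> F] --> csq l.
Proof. by move=> [a b]; exact: (cvgD (cvgM a a) (cvgM b b)). Qed.

Lemma cvgC_csq_le u l M : cvgC u l -> (forall n, csq (u n) <= M) -> csq l <= M.
Proof.
move=> /cvgC_csq ul uM.
by apply: (@closed_cvg _ _ _ FF _ (fun x => x <= M)) ul => //; exact: nearW.
Qed.

Lemma cvgC_Re_ge0 u l : cvgC u l -> (forall n, 0 <= Re (u n)) -> 0 <= Re l.
Proof.
move=> [ul _] u0.
by apply: (@closed_cvg _ _ _ FF _ [set x : R | 0 <= x]) ul; [exact: closed_ge|exact: nearW].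
Qed.

End ComplexLimits.

(** * Compactness along ultrafilters *)

Lemma ultra_fmap {T S : Type} (U : set_system T) {UU : UltraFilter U} (u : T -> S) :
  UltraFilter (u n @[n --> U]).
Proof.
split; first exact: fmap_proper_filter.
move=> G GP uG; apply/seteqP; split => A; last exact: uG.
(* Were the preimage of [A] outside [U], the preimage of its complement would lie in [U], and [G]
   would contain both sets. *)
move=> GA; have [//|UnA] := in_ultra_setVsetC (u @^-1` A) UU.
have GnA : G (~` A) by exact: uG.
by have [x []] := filter_ex (filterI GA GnA).
Qed.

(** Compactness of the interval [[- M, M]], read through ultrafilters. One ultrafilter serves all
    bounded quantities at once, in place of repeated extraction of subsequences. *)
Lemma ultra_bounded_cvg {R : realType} {T : Type} (U : set_system T)
    {UU : UltraFilter U} (u : T -> R) (M : R) :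
  (forall n, `|u n| <= M) -> exists l : R, u n @[n --> U] --> l.
Proof.
move=> uM.
have := @segment_compact R (- M) M; rewrite compact_ultra => cpt.
have [] := cpt (u n @[n --> U]) (ultra_fmap u).
  by apply: (@filterE _ U _ (fun n => u n \in `[- M, M])) => n /=; rewrite in_itv/= -ler_norml.
by move=> l [_ ?]; exists l.
Qed.

Lemma ultra_bounded_cvgC {R : realType} {T : Type} (U : set_system T)
    {UU : UltraFilter U} (u : T -> R[i]) (M : R) :
  (forall n, csq (u n) <= M) -> exists l, cvgC U u l.
Proof.
move=> uM.
have uM' n : cabs (u n) <= Num.sqrt M.
  by rewrite ler_sqrt// (le_trans (csq_ge0 _) (uM n)).
have [a ua] := ultra_bounded_cvg (fun n => le_trans (normRe_le (u n)) (uM' n)).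
have [b ub] := ultra_bounded_cvg (fun n => le_trans (normIm_le (u n)) (uM' n)).
by exists (a +i* b)%C.
Qed.

(** * Semi-Hilbert spaces *)

Section PositiveSemidefinite.
Import Num.Def.
Local Open Scope sesquilinear_scope.

(** By the spectral theorem [D] is unitarily diagonal with nonnegative eigenvalues, and [A] is the
    adjoint of the unitary matrix times the square roots of the eigenvalues. The factor turns a Gram
    defect into coordinates of actual vectors. *)
Lemma psd_factor {R : realType} (r : nat) (D : 'M[R[i]]_r) :
  (forall p q, D q p = (D p q)^*%C) ->
  (forall c : 'I_r -> R[i], 0 <= Re (\sum_p \sum_q c p * D p q * (c q)^*%C)) ->
  exists A : 'M[R[i]]_r, forall p q, D p q = \sum_j A p j * (A q j)^*%C.
Proof.
move=> Dh Dpos.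
have Dherm : D \is hermsymmx.
  by apply/is_hermitianmxP; rewrite expr0 scale1r; apply/matrixP => p q; rewrite !mxE Dh.
have /orthomx_spectralP DE : D \is normalmx by exact: hermitian_normalmx.
set P := spectralmx D in DE; set sp := spectral_diag D in DE.
have Pu : P \is unitarymx by exact: spectral_unitarymx.
rewrite invmx_unitary// in DE.
(* Each eigenvalue is the value of the quadratic form at the matching row of [P]: it is real since
   [D] is Hermitian, and nonnegative by [Dpos]. *)
have spE j : sp 0 j = \sum_p \sum_q P j p * D p q * (P j q)^*%C.
  have : P *m D *m P^t* = diag_mx sp.
    rewrite DE !mulmxA (unitarymxP _)// mul1mx -mulmxA (unitarymxP _)// mulmx1//.
  move=> /matrixP/(_ j j); rewrite [in RHS]mxE eqxx mulr1n => <-.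
  rewrite mxE exchange_big/=; apply: eq_bigr => q _.
  by rewrite !mxE mulr_suml; apply: eq_bigr.
have spR j : sp 0 j = (Re (sp 0 j))%:C%C.
  apply: complexP => //=; rewrite spE.
  set S := \sum_p _; have : S = S^*%C.
    rewrite /S [in RHS]rmorph_sum exchange_big; apply: eq_bigr => p _.
    rewrite rmorph_sum; apply: eq_bigr => q _; rewrite !rmorphM/= conjcK -Dh; ring.
  by move=> /(congr1 (@complex.Im R)); rewrite cImJ; lra.
exists (\matrix_(p, j) ((P j p)^*%C * (Num.sqrt (Re (sp 0 j)))%:C%C)) => p q.
rewrite {1}DE mxE; apply: eq_bigr => j _; rewrite mul_mx_diag !mxE [in LHS]spR.
rewrite conjcM conjcK conjc_real.
have {1}-> : Re (sp 0 j) = Num.sqrt (Re (sp 0 j)) ^+ 2.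
  by rewrite sqr_sqrtr// spE Dpos.
by rewrite rmorphXn/=; ring.
Qed.

End PositiveSemidefinite.

Lemma geometric_squeeze {R : realType} (C a : R) :
  (forall n : nat, a <= C * 16^-1 ^+ n) -> a <= 0.
Proof.
move=> aC; have c : C * 16^-1 ^+ n @[n --> \oo] --> C * (0 : R).
  by apply: cvgM; [exact: cvg_cst|apply: cvg_expr; rewrite ger0_norm; lra].
rewrite -(mulr0 C) -(cvg_lim _ c)//.
by apply: limr_ge; [apply: cvgP c|exact: nearW].
Qed.

(* The product is only a semi-inner product: L^2 functions are not identified up to
   almost everywhere equality.  Completeness is stated for geometrically Cauchy
   sequences, with an explicit rate so that no notion of limit is needed. *)
Record semiHilbert (R : realType) := SemiHilbert {
  vec :> lmodType R[i];
  ip : vec -> vec -> R[i];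
  ip_linear : forall a x y z, ip (a *: x + y) z = a * ip x z + ip y z;
  ip_conj : forall x y, ip y x = (ip x y)^*%C;
  ip_pos : forall x, 0 <= Re (ip x x);
  ip_complete : forall u : nat -> vec,
    (forall n m, Re (ip (u (n + m)%N - u n) (u (n + m)%N - u n)) <= 4 * 16^-1 ^+ n) ->
    exists g, forall n, Re (ip (u n - g) (u n - g)) <= 4 * 16^-1 ^+ n }.

Section SemiHilbertTheory.
Context {R : realType} (H : semiHilbert R).
Implicit Types (x y z : H) (a : R[i]).
Local Notation "<< x , y >>" := (ip x y).

Definition nrm2 x : R := Re <<x, x>>.

Lemma ip0l z : <<0, z>> = 0.
Proof.
have := ip_linear 1 0 0 z; rewrite scaler0 addr0 mul1r.
by move=> /eqP; rewrite -subr_eq0 opprD addNKr oppr_eq0 => /eqP.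
Qed.

Lemma ipDl x y z : <<x + y, z>> = <<x, z>> + <<y, z>>.
Proof. by have := ip_linear 1 x y z; rewrite scale1r mul1r. Qed.

Lemma ipZl a x z : <<a *: x, z>> = a * <<x, z>>.
Proof. by have := ip_linear a x 0 z; rewrite addr0 ip0l addr0. Qed.

Lemma ipNl x z : <<- x, z>> = - <<x, z>>.
Proof. by rewrite -scaleN1r ipZl mulN1r. Qed.

Lemma ipDr x y z : <<z, x + y>> = <<z, x>> + <<z, y>>.
Proof. by rewrite ip_conj ipDl rmorphD/= -!ip_conj. Qed.

Lemma ipZr a x z : <<z, a *: x>> = a^*%C * <<z, x>>.
Proof. by rewrite ip_conj ipZl rmorphM/= -!ip_conj. Qed.

Lemma ipNr x z : <<z, - x>> = - <<z, x>>.
Proof. by rewrite ip_conj ipNl rmorphN/= -ip_conj. Qed.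

Lemma ip0r z : <<z, 0>> = 0.
Proof. by rewrite ip_conj ip0l conjc0. Qed.

Lemma ip_suml I (s : seq I) (P : pred I) (F : I -> H) z :
  <<\sum_(i <- s | P i) F i, z>> = \sum_(i <- s | P i) <<F i, z>>.
Proof. exact: (big_morph (fun x => <<x, z>>) (fun x y => ipDl x y z) (ip0l z)). Qed.

Lemma ip_sumr I (s : seq I) (P : pred I) (F : I -> H) z :
  <<z, \sum_(i <- s | P i) F i>> = \sum_(i <- s | P i) <<z, F i>>.
Proof. exact: (big_morph (fun x => <<z, x>>) (fun x y => ipDr x y z) (ip0r z)). Qed.

Definition ipE := (ipDl, ipDr, ipNl, ipNr, ipZl, ipZr).

Lemma nrm2_ge0 x : 0 <= nrm2 x. Proof. exact: ip_pos. Qed.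

Lemma ipxx x : <<x, x>> = (nrm2 x)%:C%C.
Proof.
apply: complexP => //=; have := ip_conj x x => /(congr1 (@complex.Im R)).
by rewrite !partE; lra.
Qed.

Lemma nrm2ZD a x y :
  nrm2 (a *: x + y) = csq a * nrm2 x + 2 * Re (a * <<x, y>>) + nrm2 y.
Proof.
rewrite /nrm2 !ipE (ip_conj x y) !partE /csq !expr2.
have -> : Im <<x, x>> = 0 by rewrite ipxx.
by ring.
Qed.

Lemma nrm2Z a x : nrm2 (a *: x) = csq a * nrm2 x.
Proof. by rewrite -[a *: x]addr0 nrm2ZD ip0r mulr0 /nrm2 ip0l /= mulr0 !addr0. Qed.

Lemma nrm2N x : nrm2 (- x) = nrm2 x.
Proof. by rewrite /nrm2 !ipE opprK. Qed.

Lemma nrm2D x y : nrm2 (x + y) = nrm2 x + 2 * Re <<x, y>> + nrm2 y.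
Proof. by rewrite -[x]scale1r nrm2ZD csq_real scale1r mul1r expr1n mul1r. Qed.

Lemma nrm2B x y : nrm2 (x - y) = nrm2 x - 2 * Re <<x, y>> + nrm2 y.
Proof. by rewrite nrm2D nrm2N ipNr cReN mulrN. Qed.

Lemma nrm2D_le x y : nrm2 (x + y) <= 2 * nrm2 x + 2 * nrm2 y.
Proof. by have := nrm2_ge0 (x - y); rewrite nrm2B nrm2D; lra. Qed.

Lemma cauchy_schwarz x y : csq <<x, y>> <= nrm2 x * nrm2 y.
Proof.
(* Positivity of the squared norm of [y] minus [s] times the conjugate of [<<x, y>>] times [x]; the
   choice [s = 1 / nrm2 x] gives the inequality. *)
have expand (s : R) :
    0 <= s ^+ 2 * csq <<x, y>> * nrm2 x - 2 * s * csq <<x, y>> + nrm2 y.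
  have := nrm2_ge0 ((- s%:C%C * <<x, y>>^*%C) *: x + y).
  rewrite nrm2ZD csqM csqJ csqN csq_real !partE /csq /=; lra.
(* A null vector need not be [0]. For it the bound is affine in [s], and a large [s] violates it
   unless [<<x, y>>] vanishes. *)
have [x0|x0] := eqVneq (nrm2 x) 0.
  rewrite x0 mul0r leNgt; apply/negP => c0.
  have := expand (nrm2 y / csq <<x, y>>); rewrite x0 mulr0 add0r.
  rewrite -mulrA mulfVK ?gt_eqF//.
  have := expand ((nrm2 y + 1) / csq <<x, y>>); rewrite x0 mulr0 add0r.
  rewrite -mulrA mulfVK ?gt_eqF//.
  have := nrm2_ge0 y; lra.
have xgt0 : 0 < nrm2 x by rewrite lt_neqAle eq_sym x0 nrm2_ge0.
have := expand (nrm2 x)^-1.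
rewrite -(ler_pM2l xgt0) mulr0 [X in _ <= X -> _](_ : _ = nrm2 x * nrm2 y - csq <<x, y>>).
  by rewrite subr_ge0.
by field.
Qed.

Lemma nrm2_eq0_ip x y : nrm2 x = 0 -> <<y, x>> = 0.
Proof.
move=> x0; apply: csq_eq0; apply/eqP.
by rewrite eq_le csq_ge0 andbT (le_trans (cauchy_schwarz _ _))// x0 mulr0.
Qed.

(** In squared norms the triangle inequality costs a factor 2, and the bound 4 reproduces itself:
    [2 * 4 / 16 + 2 <= 4]. *)
Lemma fast_cauchy_cvg (u : nat -> H) :
  (forall n, nrm2 (u n.+1 - u n) <= 16^-1 ^+ n) ->
  exists g, forall n, nrm2 (u n - g) <= 4 * 16^-1 ^+ n.
Proof.
move=> du; apply: ip_complete => n m; elim: m n => [|m IH] n.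
  by rewrite addn0 subrr ip0l /= mulr_ge0// exprn_ge0// invr_ge0.
rewrite -[u _ - _](subrKA (u n.+1)) -addSnnS.
have := nrm2D_le (u (n.+1 + m)%N - u n.+1) (u n.+1 - u n).
have e0 : (0 : R) <= 16^-1 ^+ n by rewrite exprn_ge0 ?invr_ge0.
have := IH n.+1; have := du n; rewrite /nrm2 exprS; lra.
Qed.

(* A fast minimizing sequence of [|x|^2 - 2 Re (l x)] is Cauchy by the parallelogram
   identity. *)
Lemma riesz (l : H -> R[i]) (M : R) :
  (forall a x y, l (a *: x + y) = a * l x + l y) ->
  (forall x, csq (l x) <= M * nrm2 x) ->
  exists g, forall x, l x = <<x, g>>.
Proof.
move=> lin bnd; pose F x := nrm2 x - 2 * Re (l x).
have l0 : l 0 = 0.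
  have := lin 1 0 0; rewrite scaler0 addr0 mul1r.
  by move=> /eqP; rewrite -subr_eq0 opprD addNKr oppr_eq0 => /eqP.
have lD x y : l (x + y) = l x + l y by have := lin 1 x y; rewrite scale1r mul1r.
have lZ a x : l (a *: x) = a * l x by have := lin a x 0; rewrite addr0 l0 addr0.
pose E := range F.
(* By the inequality of arithmetic and geometric means, [2 sqrt(|M| nrm2 x) <= nrm2 x + |M|], so [F]
   is bounded below. *)
have M0 x : 2 * Re (l x) <= nrm2 x + `|M|.
  have b : Re (l x) ^+ 2 <= `|M| * nrm2 x.
    rewrite (le_trans _ (le_trans (bnd x) _)) ?lerDl ?sqr_ge0//.
    by rewrite ler_wpM2r ?nrm2_ge0 ?ler_norm.
  have := nrm2_ge0 x; have := normr_ge0 M => p q.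
  rewrite real_leNgt ?num_real//; apply/negP => c.
  have : (nrm2 x + `|M|) ^+ 2 < (2 * Re (l x)) ^+ 2.
    by rewrite ltr_pXn2r ?nnegrE//; lra.
  have := sqr_ge0 (nrm2 x - `|M|); rewrite !expr2 in b *; nra.
have hasinf : has_inf E.
  split; first by exists (F 0), 0.
  by exists (- `|M|) => _ [x _ <-]; rewrite /F; have := M0 x; lra.
have infF x : inf E <= F x by apply: ge_inf; [exact: hasinf.2|exists x].
have /(_ _)/cid2-/all_sig[u Fu] : forall n, exists2 x, True & F x < inf E + 64^-1 * 16^-1 ^+ n.
  move=> n; have [] := @inf_adherent _ E (64^-1 * 16^-1 ^+ n) _ hasinf.
    by rewrite mulr_gt0// ?exprn_gt0 ?invr_gt0.
  by move=> _ [x _ <-] ?; exists x.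
have u_cauchy n : nrm2 (u n.+1 - u n) <= 16^-1 ^+ n.
  (* At the midpoint, [2 F(u n.+1) + 2 F(u n) - 4 F(midpoint)] is exactly [nrm2 (u n.+1 - u n)]; the
     slack [64^-1] leaves ample room. *)
  have /= := infF (2^-1%:C%C *: (u n.+1 + u n)); rewrite /F nrm2Z lZ lD nrm2D.
  rewrite csq_real cReM /= mul0r subr0 cReD nrm2B.
  have e0 : (0 : R) <= 16^-1 ^+ n by rewrite exprn_ge0 ?invr_ge0.
  have := Fu n; have := Fu n.+1; rewrite /F exprS /=; lra.
have [g ug] := fast_cauchy_cvg u_cauchy.
exists g => x; apply/eqP; rewrite -subr_eq0; apply/eqP/csq_eq0/eqP.
rewrite eq_le csq_ge0 andbT; pose N := nrm2 x; have N0 : 0 <= N by exact: nrm2_ge0.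
(* The constant collects twice the bound [zn] and twice Cauchy-Schwarz against the rate
   [4 * 16^-1 ^+ n]. *)
apply: (@geometric_squeeze _ ((1 + N) + 8 * N)) => n.
have e0 : (0 : R) <= 16^-1 ^+ n by rewrite exprn_ge0 ?invr_ge0.
have zn : csq (l x - <<x, u n>>) <= (1 + N) * (64^-1 * 16^-1 ^+ n).
  pose z := l x - <<x, u n>>; pose s : R := (1 + N)^-1.
  have s0 : 0 < s by rewrite invr_gt0; lra.
  have sN : (1 + N) * s = 1 by rewrite /s mulfV// gt_eqF//; lra.
  (* Comparing [F] at [u n] and at [u n] moved along [x] by [s] times the conjugate of [z] gives [s
     * csq z * (2 - s * N) <= 64^-1 * 16^-1 ^+ n]. The choice [s = 1 / (1 + N)] keeps [s * N <= 1]
     and makes sense even for a null [x]. *)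
  have := infF ((s%:C%C * z^*%C) *: x + u n); rewrite /F lin nrm2ZD cReD.
  have := Fu n; rewrite /F csqM csq_real csqJ -/N.
  have -> : Re (s%:C%C * z^*%C * <<x, u n>>) = Re (s%:C%C * z^*%C * l x) - s * csq z.
    rewrite /z /csq !partE /=; ring.
  rewrite -/z; move: (csq z) (csq_ge0 z) => c c0 A B.
  have {A B} : s * (c * (2 - s * N)) <= 64^-1 * 16^-1 ^+ n by lra.
  rewrite -(ler_pM2l (_ : 0 < 1 + N)); last by lra.
  rewrite (mulrA _ s) sN mul1r; apply: le_trans; rewrite ler_peMr//.
  have : 0 <= s * 1 by lra.
  lra.
have := csqD_le (l x - <<x, u n>>) <<x, u n - g>>.
rewrite ipDr ipNr addrA subrK.
have := le_trans (cauchy_schwarz x (u n - g)) (ler_wpM2l N0 (ug n)).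
rewrite ipDr ipNr; nra.
Qed.

(** The limits of [<<h, u n>>] along [U] form a bounded linear functional of [h], which [riesz]
    represents. *)
Lemma weak_limit {T : Type} (U : set_system T) {UU : UltraFilter U} (u : T -> H) (M : R) :
  (forall n, nrm2 (u n) <= M) ->
  exists g, forall h, cvgC U (fun n => <<h, u n>>) <<h, g>>.
Proof.
move=> uM.
have bnd h n : csq <<h, u n>> <= M * nrm2 h.
  by rewrite (le_trans (cauchy_schwarz _ _))// mulrC ler_wpM2r ?nrm2_ge0.
have /choice[l lP] h : exists l, cvgC U (fun n => <<h, u n>>) l.
  exact: (ultra_bounded_cvgC (bnd h)).
have [|h|g gP] := @riesz l M.
- move=> a x y; apply: (cvgC_unique (lP _)).
  under eq_fun do rewrite ip_linear.
  by apply: cvgCD => //; apply: cvgCM => //; exact: cvgC_cst.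
- exact: cvgC_csq_le (lP h) (bnd h).
- by exists g => h; rewrite -gP.
Qed.

Fixpoint orthonormal (s : seq H) : Prop :=
  if s is e :: s' then
    [/\ nrm2 e = 1, forall y, y \in s' -> <<y, e>> = 0 & orthonormal s']
  else True.

Definition proj (s : seq H) x : H := \sum_(e <- s) <<x, e>> *: e.

Lemma ip_proj s x e : orthonormal s -> e \in s -> <<proj s x, e>> = <<x, e>>.
Proof.
rewrite /proj => son es; rewrite ip_suml; under eq_bigr do rewrite ipZl.
elim: s son es => // a s IH [a1 sa son]; rewrite inE big_cons.
have [-> _|ea /= es] := eqVneq e a; last first.
  by rewrite IH// (ip_conj e a) (sa e es) conjc0 mulr0 add0r.
rewrite ipxx a1 mulr1 big1_seq ?addr0// => y /= /sa ->.
by rewrite mulr0.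
Qed.

Lemma gram_schmidt (vs : seq H) :
  exists2 s, orthonormal s &
    forall x, (forall e, e \in s -> <<x, e>> = 0) -> forall v, v \in vs -> <<x, v>> = 0.
Proof.
elim: vs => [|v vs [s son sP]]; first by exists [::].
pose w := v - proj s v.
have ws e : e \in s -> <<w, e>> = 0.
  by move=> es; rewrite ipDl ipNl ip_proj// subrr.
have xv x : (forall e, e \in s -> <<x, e>> = 0) -> <<x, v>> = <<x, w>>.
  move=> xs; rewrite /w ipDr ipNr ip_sumr big1_seq ?subr0// => e /= es.
  by rewrite ipZr xs// mulr0.
have [w0|w0] := eqVneq (nrm2 w) 0.
  exists s => // x xs y; rewrite inE => /orP[/eqP ->|]; last exact: sP.
  by rewrite xv// nrm2_eq0_ip.
pose c : R := (Num.sqrt (nrm2 w))^-1.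
have wgt0 : 0 < nrm2 w by rewrite lt_neqAle eq_sym w0 nrm2_ge0.
exists (c%:C%C *: w :: s) => /=.
  split => //.
    by rewrite nrm2Z csq_real exprVn sqr_sqrtr ?nrm2_ge0// mulVf.
  by move=> y ys; rewrite ip_conj ipZl ws// mulr0 conjc0.
move=> x xs; have xs' e : e \in s -> <<x, e>> = 0 by move=> es; apply: xs; rewrite inE es orbT.
move=> y; rewrite inE => /orP[/eqP ->|]; last exact: sP.
rewrite xv//; have := xs _ (mem_head _ _); rewrite ipZr => /eqP.
rewrite mulf_eq0 => /orP[|/eqP//]; rewrite conjc_eq0 => /eqP[] /eqP.
by rewrite invr_eq0 sqrtr_eq0 leNgt wgt0.
Qed.

(** Parseval's identity. The second hypothesis makes [s] a maximal orthonormal list, so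
    [x - proj s x], being orthogonal to [s], is null. *)
Lemma finite_basis_ip s x y : orthonormal s ->
  (forall x, (forall e, e \in s -> <<x, e>> = 0) -> nrm2 x = 0) ->
  <<x, y>> = \sum_(e <- s) <<x, e>> * <<e, y>>.
Proof.
move=> son sfull; transitivity <<proj s x, y>>; last first.
  by rewrite ip_suml; under eq_bigr do rewrite ipZl.
apply/eqP; rewrite -subr_eq0 -ipNl -ipDl ip_conj nrm2_eq0_ip ?conjc0//.
by apply: sfull => e es; rewrite ipDl ipNl ip_proj// subrr.
Qed.

(** The hypothesis is infinite dimension modulo null vectors. Each new vector is taken orthogonal to
    a Gram-Schmidt list of [vs] and the vectors already chosen. *)
Lemma fresh_orthonormal :
  (forall s, orthonormal s -> exists2 x, nrm2 x = 1 & forall e, e \in s -> <<x, e>> = 0) ->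
  forall n (vs : seq H), exists2 f : 'I_n -> H,
    forall i j, <<f i, f j>> = (i == j)%:R & forall i v, v \in vs -> <<f i, v>> = 0.
Proof.
move=> inf; elim=> [|n IH] vs; first by exists (fun=> 0); case.
have [f fon fvs] := IH vs.
have [s son sP] := gram_schmidt (vs ++ codom f).
have [x x1 xs] := inf _ son.
have xf i : <<x, f i>> = 0.
  by apply: sP xs _ _; rewrite mem_cat codom_f orbT.
exists (fun i => if unlift ord0 i is Some j then f j else x).
  move=> i j; case: unliftP => [i'|] ->; case: unliftP => [j'|] ->.
  - by rewrite fon (inj_eq lift_inj).
  - by rewrite ip_conj xf conjc0.
  - by rewrite xf.
  - by rewrite ipxx x1 eqxx.
move=> i v vvs; case: unliftP => [i'|] _; first exact: fvs.
by apply: sP xs _ _; rewrite mem_cat vvs.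
Qed.

(* [G - Gram psi] is positive semidefinite, being the limit of the Gram matrices of
   [phi n - psi]. *)
Lemma realize_gram {T : Type} (F : set_system T) {FF : ProperFilter F} (r : nat)
    (phi : T -> 'I_r -> H) (psi b : 'I_r -> H) (G : 'I_r -> 'I_r -> R[i]) :
  (forall p h, cvgC F (fun n => <<h, phi n p>>) <<h, psi p>>) ->
  (forall p q, cvgC F (fun n => <<phi n p, phi n q>>) (G p q)) ->
  exists2 phi' : 'I_r -> H, forall p q, <<phi' p, phi' q>> = G p q &
    forall p q, <<phi' p, b q>> = <<psi p, b q>>.
Proof.
move=> wphi gphi.
have wphi' p h : cvgC F (fun n => <<phi n p, h>>) <<psi p, h>>.
  rewrite (ip_conj h); under eq_fun do rewrite (ip_conj h).
  exact: cvgCJ.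
have [inf|] := pselect (forall s, orthonormal s ->
    exists2 x, nrm2 x = 1 & forall e, e \in s -> <<x, e>> = 0); last first.
  (* In finite dimension [<<phi n p, phi n q>>] is a finite sum of products of convergent
     coefficients, so [psi] itself has the Gram matrix [G]. *)
  move=> /existsNP[s] /not_implyP[son sP]; exists psi => // p q.
  have sfull x : (forall e, e \in s -> <<x, e>> = 0) -> nrm2 x = 0.
    move=> xs; apply: contrapT => /eqP x0; apply: sP.
    have xgt0 : 0 < nrm2 x by rewrite lt_neqAle eq_sym x0 nrm2_ge0.
    exists ((Num.sqrt (nrm2 x))^-1%:C%C *: x).
      by rewrite nrm2Z csq_real exprVn sqr_sqrtr ?nrm2_ge0// mulVf.
    by move=> e es; rewrite ipZl xs// mulr0.
  apply: cvgC_unique (gphi p q); rewrite (finite_basis_ip _ _ son sfull).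
  under eq_fun do rewrite (finite_basis_ip _ _ son sfull).
  by apply: cvgC_big => [*|e]; [exact: cvgCD|exact: cvgCM].
pose D := \matrix_(p, q) (G p q - <<psi p, psi q>>).
have gD p q : cvgC F (fun n => <<phi n p - psi p, phi n q - psi q>>) (D p q).
  have -> : D p q = G p q - <<psi p, psi q>> - (<<psi p, psi q>> - <<psi p, psi q>>).
    by rewrite mxE subrr subr0.
  have ipBB x y z w : <<x - y, z - w>> = <<x, z>> - <<x, w>> - (<<y, z>> - <<y, w>>).
    by rewrite ipDl ipNl !ipDr !ipNr.
  under eq_fun do rewrite ipBB.
  by apply: cvgCB; apply: cvgCB => //; exact: cvgC_cst.
have [p q|c|A AD] := @psd_factor _ _ D.
- apply: (cvgC_unique (gD q p)); under eq_fun do rewrite ip_conj.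
  exact: cvgCJ.
- pose v n := \sum_p c p *: (phi n p - psi p).
  have cv : cvgC F (fun n => <<v n, v n>>) (\sum_p \sum_q c p * D p q * (c q)^*%C).
    rewrite /v; under eq_fun do rewrite ip_suml.
    apply: cvgC_sum => p; under eq_fun do rewrite ip_sumr.
    apply: cvgC_sum => q; under eq_fun do rewrite ipZl ipZr mulrCA mulrC.
    by apply: cvgCM; [apply: cvgCM|]; [exact: cvgC_cst| |exact: cvgC_cst].
  by apply: cvgC_Re_ge0 cv _ => n; exact: nrm2_ge0.
have [e eon evs] := fresh_orthonormal inf r (codom psi ++ codom b).
have epsi j p : <<e j, psi p>> = 0 by apply: evs; rewrite mem_cat codom_f.
have eb j p : <<e j, b p>> = 0 by apply: evs; rewrite mem_cat codom_f orbT.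
(* [rho] has Gram matrix [D] by the factorization, and lies in the span of fresh vectors orthogonal
   to every [psi p] and [b p]. *)
pose rho p := \sum_j A p j *: e j.
have rho0 p x : (forall j, <<e j, x>> = 0) -> <<rho p, x>> = 0.
  by move=> ex; rewrite ip_suml big1// => j _; rewrite ipZl ex mulr0.
exists (fun p => psi p + rho p) => p q; last first.
  by rewrite ipDl rho0 ?addr0.
have rpsi p' q' : <<rho p', psi q'>> = 0 by exact: rho0.
rewrite ipDl 2!ipDr (ip_conj (rho q)) !rpsi conjc0 addr0 add0r.
have -> : G p q = <<psi p, psi q>> + D p q by rewrite mxE addrC subrK.
congr (_ + _).
rewrite AD ip_suml; apply: eq_bigr => j _; rewrite ipZl ip_sumr; congr (_ * _).
rewrite (bigD1 j)//= big1 ?addr0 => [|i ij]; rewrite ipZr eon ?eqxx ?mulr1//.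
by rewrite eq_sym (negbTE ij) mulr0.
Qed.

End SemiHilbertTheory.

(** * Best approximation in a Hilbert tensor product *)

(** Every [a p] occurs with weight [M / 2] in [r - 1] ordered pairs as first index and in [r - 1] as
    second. *)
Lemma offdiagonal_sum {R : realType} (r : nat) (a : 'I_r -> R) (M : R) :
  \sum_p (a p + \sum_(q | q != p) - (M / 2 * (a p + a q))) =
  (1 - (r - 1)%N%:R * M) * \sum_p a p.
Proof.
have sum1 : \sum_(p < r) \sum_(q | q != p) a p = (r - 1)%N%:R * \sum_p a p.
  rewrite mulr_sumr; apply: eq_bigr => p _; rewrite sumr_const mulr_natl.
  by rewrite cardC1 card_ord subn1.
have sum2 : \sum_(p < r) \sum_(q | q != p) a q = (r - 1)%N%:R * \sum_p a p.
  rewrite -sum1 (exchange_big_dep predT)//=; apply: eq_bigr => q _.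
  by apply: eq_bigl => p; rewrite eq_sym.
rewrite big_split/=; under [X in _ + X]eq_bigr do rewrite sumrN -mulr_sumr big_split/=.
rewrite sumrN -mulr_sumr big_split/= sum1 sum2; by field.
Qed.

(** An off-diagonal term has modulus at most [M * cabs (c p) * cabs (c q)], hence at most
    [M / 2 * (csq (c p) + csq (c q))]. *)
Lemma diagonal_dominance {R : realType} (r : nat) (g : 'I_r -> 'I_r -> R[i]) (M : R)
    (c : 'I_r -> R[i]) :
  0 <= M -> (forall p, g p p = 1) -> (forall p q, p != q -> cabs (g p q) <= M) ->
  (1 - (r - 1)%N%:R * M) * \sum_p csq (c p) <=
    Re (\sum_p \sum_q c p * (c q)^*%C * g p q).
Proof.
move=> M0 gd goff.
pose F (p q : 'I_r) : R := if p == q then csq (c p) else - (M / 2 * (csq (c p) + csq (c q))).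
have ReF p q : F p q <= Re (c p * (c q)^*%C * g p q).
  rewrite /F; have [<-|pq] := eqVneq p q.
    by rewrite gd mulr1 mulcJ.
  have h1 : `|Re (c p * (c q)^*%C * g p q)| <= cabs (c p) * cabs (c q) * M.
    rewrite (le_trans (normRe_le _))// !cabsM cabsJ.
    by rewrite ler_wpM2l ?mulr_ge0 ?cabs_ge0// goff.
  have h2 : cabs (c p) * cabs (c q) * M <= M / 2 * (csq (c p) + csq (c q)).
    rewrite -!sqr_cabs mulrC -mulrA ler_wpM2l//.
    by have := sqr_ge0 (cabs (c p) - cabs (c q)); rewrite !expr2; lra.
  have := le_trans h1 h2; rewrite ler_norml => /andP[]; lra.
apply: (@le_trans _ _ (\sum_p \sum_q F p q)); last first.
  rewrite cRe_sum; apply: ler_sum => p _; rewrite cRe_sum; exact: ler_sum.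
have -> : \sum_p \sum_q F p q =
    \sum_p (csq (c p) + \sum_(q | q != p) - (M / 2 * (csq (c p) + csq (c q)))).
  apply: eq_bigr => p _; rewrite (bigD1 p)//= /F eqxx; congr (_ + _).
  by apply: eq_bigr => q /negbTE; rewrite eq_sym => ->.
by rewrite offdiagonal_sum.
Qed.

(* A map [tau] with these two properties is, up to null vectors, the tensor product
   [x_1, ..., x_d |-> x_1 (x) ... (x) x_d] into the Hilbert tensor product of the [H k]:
   its multilinearity follows. *)
Section TensorApproximation.
Context {R : realType} {d : nat} (H : 'I_d -> semiHilbert R) (K : semiHilbert R).
Variable tau : (forall k, H k) -> K.
Hypothesis tau_ip : forall x y, ip (tau x) (tau y) = \prod_k ip (x k) (y k).
Hypothesis tau_total : forall g, (forall x, ip (tau x) g = 0) -> nrm2 g = 0.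

Lemma tau_dfwith_ip (x : forall k, H k) k (y : H k) w :
  ip (tau (dfwith x y)) (tau w) = ip y (w k) * \prod_(l | l != k) ip (x l) (w l).
Proof.
rewrite tau_ip (bigD1 k)//= dfwith_in; congr (_ * _); apply: eq_bigr => l lk.
by rewrite dfwith_out// eq_sym.
Qed.

(** The defect of linearity is orthogonal to every [tau w], hence null by [tau_total]; the identity
    therefore holds after pairing with any [f]. *)
Lemma tau_linear (x : forall k, H k) k (a : R[i]) (y z : H k) f :
  ip (tau (dfwith x (a *: y + z))) f =
  a * ip (tau (dfwith x y)) f + ip (tau (dfwith x z)) f.
Proof.
pose v := tau (dfwith x (a *: y + z)) - (a *: tau (dfwith x y) + tau (dfwith x z)).
have v0 : nrm2 v = 0.
  apply: tau_total => w; rewrite ip_conj ipDl ipNl ip_linear !tau_dfwith_ip.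
  by rewrite ip_linear mulrDl mulrA subrr conjc0.
apply/eqP; rewrite -subr_eq0 -ip_linear -ipNl -ipDl -/v.
by rewrite ip_conj nrm2_eq0_ip ?conjc0.
Qed.

(** [b] is [f] contracted with the factors [x l], [l != k]. It exists by [riesz], the bound being
    Cauchy-Schwarz in [K] together with the product formula for the norm of a tensor. *)
Lemma tau_riesz (x : forall k, H k) k f :
  exists b : H k, forall y, ip (tau (dfwith x y)) f = ip y b.
Proof.
apply: (@riesz _ _ _ ((\prod_(l | l != k) nrm2 (x l)) * nrm2 f)) => [a y z|y].
  exact: tau_linear.
rewrite (le_trans (cauchy_schwarz _ _))// mulrAC ler_wpM2r ?nrm2_ge0//.
rewrite /nrm2 tau_ip; under eq_bigr do rewrite ipxx.
rewrite -(rmorph_prod (real_complex R))/= (bigD1 k)//= dfwith_in mulrC ler_wpM2r ?nrm2_ge0//.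
rewrite le_eqVlt; apply/orP; left; apply/eqP; apply: eq_bigr => l lk.
by rewrite dfwith_out// eq_sym.
Qed.

Variable r : nat.

Definition tsum (c : 'I_r -> R[i]) (phi : forall k, 'I_r -> H k) : K :=
  \sum_p c p *: tau (fun k => phi k p).

Definition incoherent (muk : 'I_d -> R) (phi : forall k, 'I_r -> H k) : Prop :=
  forall k, (forall p, nrm2 (phi k p) = 1) /\
            (forall p q, p != q -> cabs (ip (phi k p) (phi k q)) <= muk k).

(** Its real part is the squared error, as a function of the only data that have to converge: the
    coefficients, the pairings [s p] of [f] with the tensors, and the Gram entries [g p q] of the
    tensors. *)
Definition error_form (f : K) (c : 'I_r -> R[i]) (s : 'I_r -> R[i])
    (g : 'I_r -> 'I_r -> R[i]) : R[i] :=
  ip f f - 2%:C%C * (\sum_p (c p)^*%C * s p) + \sum_p \sum_q c p * (c q)^*%C * g p q.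

Lemma ip_tsum c phi : ip (tsum c phi) (tsum c phi) =
  \sum_p \sum_q c p * (c q)^*%C * \prod_k ip (phi k p) (phi k q).
Proof.
rewrite ip_suml; apply: eq_bigr => p _; rewrite ip_sumr; apply: eq_bigr => q _.
by rewrite ipZl ipZr tau_ip mulrA.
Qed.

Lemma nrm2_error f c phi :
  nrm2 (f - tsum c phi) = Re (error_form f c (fun p => ip f (tau (fun k => phi k p)))
    (fun p q => \prod_k ip (phi k p) (phi k q))).
Proof.
rewrite nrm2B /error_form -ip_tsum 2!cReD cReN cReM /= mul0r subr0; congr (_ - _ * Re _ + _).
by rewrite ip_sumr; apply: eq_bigr => p _; rewrite ipZr.
Qed.

(** Induction on the list [s] of factors already repaired; the remaining ones still equal [psi k],
    so that [realize_gram] can be applied to the next. *)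
Lemma realize_grams {T : Type} (F : set_system T) {FF : ProperFilter F}
    (phi : T -> forall k, 'I_r -> H k) (psi : forall k, 'I_r -> H k)
    (G : forall k : 'I_d, 'I_r -> 'I_r -> R[i]) (f : K) :
  (forall k p h, cvgC F (fun n => ip h (phi n k p)) (ip h (psi k p))) ->
  (forall k p q, cvgC F (fun n => ip (phi n k p) (phi n k q)) (G k p q)) ->
  exists2 phi' : forall k, 'I_r -> H k,
    forall k p q, ip (phi' k p) (phi' k q) = G k p q &
    forall p, ip (tau (fun k => phi' k p)) f = ip (tau (fun k => psi k p)) f.
Proof.
move=> wphi gphi.
suff /(_ (enum 'I_d))[phi' [gphi' _ fphi']] : forall s : seq 'I_d,
    exists phi' : forall k, 'I_r -> H k,
    [/\ forall k p q, k \in s -> ip (phi' k p) (phi' k q) = G k p q,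
        forall k, k \notin s -> phi' k = psi k &
        forall p, ip (tau (fun k => phi' k p)) f = ip (tau (fun k => psi k p)) f].
  by exists phi' => // k p q; rewrite gphi'// mem_enum.
elim=> [|k s [phi' [gphi' ephi' fphi']]]; first by exists psi.
have [ks|ks] := boolP (k \in s).
  exists phi'; split => // [l p q|l]; rewrite inE.
    by move=> /orP[/eqP ->|]; exact: gphi'.
  by rewrite negb_or => /andP[_]; exact: ephi'.
(* The [b p] depend on the factors repaired so far and are recomputed for each [k]. *)
have /choice[b bP] p := tau_riesz (fun l => phi' l p) k f.
have [chi gchi bchi] := realize_gram b (wphi k) (gphi k).
exists (dfwith phi' chi); split => [l p q|l|p].
- rewrite inE; have [->|lk /= ls] := eqVneq l k; first by rewrite dfwith_in gchi.
  by rewrite dfwith_out 1?eq_sym// gphi'.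
- by rewrite inE negb_or => /andP[lk ls]; rewrite dfwith_out 1?eq_sym// ephi'.
- have -> : (fun l => dfwith phi' chi l p) = dfwith (fun l => phi' l p) (chi p).
    apply: functional_extensionality_dep => l.
    have [->|lk] := eqVneq l k; first by rewrite !dfwith_in.
    by rewrite !dfwith_out// eq_sym.
  rewrite bP bchi -ephi'// -bP -fphi'; congr (ip (tau _) _).
  apply: functional_extensionality_dep => l.
  have [->|lk] := eqVneq l k; first by rewrite !dfwith_in.
  by rewrite !dfwith_out// eq_sym.
Qed.

(** The [tau (x n)] have norm 1, so they have a weak limit [g]. Against each [tau w] it agrees with
    [tau y], by the product formula, and totality makes [g - tau y] null. *)
Lemma tau_weak_cvg {T : Type} (U : set_system T) {UU : UltraFilter U}
    (x : T -> forall k, H k) (y : forall k, H k) (f : K) :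
  (forall n k, nrm2 (x n k) = 1) ->
  (forall k h, cvgC U (fun n => ip h (x n k)) (ip h (y k))) ->
  cvgC U (fun n => ip f (tau (x n))) (ip f (tau y)).
Proof.
move=> x1 xy.
have [n|g gP] := @weak_limit _ _ _ U _ (fun n => tau (x n)) 1.
  by rewrite /nrm2 tau_ip big1// => k _; rewrite ipxx x1.
have g0 : nrm2 (g - tau y) = 0.
  apply: tau_total => w; apply/eqP; rewrite ipDr ipNr subr_eq0; apply/eqP.
  apply: cvgC_unique (gP (tau w)) _; rewrite tau_ip; under eq_fun do rewrite tau_ip.
  exact: cvgC_prod.
suff -> : ip f (tau y) = ip f g by [].
by apply/eqP; rewrite eq_sym -subr_eq0 -ipNr -ipDr nrm2_eq0_ip.
Qed.

Theorem best_approximation (f : K) (muk : 'I_d -> R) :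
  (forall k, 0 <= muk k) -> (r - 1)%N%:R * \prod_k muk k < 1 ->
  (exists phi, incoherent muk phi) ->
  exists c phi, incoherent muk phi /\ forall c' phi', incoherent muk phi' ->
    nrm2 (f - tsum c phi) <= nrm2 (f - tsum c' phi').
Proof.
move=> mu0 mu1 [phi0 phi0P]; set M := \prod_k _ in mu1.
have M0 : 0 <= M by exact: prodr_ge0.
pose E := [set e | exists c phi, incoherent muk phi /\ e = nrm2 (f - tsum c phi)].
have hasinf : has_inf E.
  split; first by exists (nrm2 (f - tsum (fun=> 0) phi0)), (fun=> 0), phi0.
  by exists 0 => _ [c [phi [_ ->]]]; exact: nrm2_ge0.
have /choice[u uP] : forall n : nat, exists u : ('I_r -> R[i]) * (forall k, 'I_r -> H k),
    incoherent muk u.2 /\ nrm2 (f - tsum u.1 u.2) < inf E + n.+1%:R^-1.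
  move=> n; have [|_ [c [phi [? ->]]] ?] := @inf_adherent _ E n.+1%:R^-1 _ hasinf.
    by rewrite invr_gt0.
  by exists (c, phi).
pose c n := (u n).1; pose phi n := (u n).2.
have phi1 n k p : nrm2 (phi n k p) = 1 by exact: ((uP n).1 k).1.
have gram_le n p q : p != q -> cabs (\prod_k ip (phi n k p) (phi n k q)) <= M.
  move=> pq; rewrite cabs_prod; apply: ler_prod => k _.
  by rewrite cabs_ge0 ((uP n).1 k).2.
(* [diagonal_dominance] bounds the coefficients by the squared norm of the sum, which is at most
   twice that of [f] plus twice the squared error; [n.+1%:R^-1 <= 1] bounds the latter by
   [inf E + 1]. *)
have c_le n p : csq (c n p) <=
    (2 * nrm2 f + 2 * (inf E + 1)) / (1 - (r - 1)%N%:R * M).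
  rewrite ler_pdivlMr ?subr_gt0// mulrC.
  have cp : csq (c n p) <= \sum_p csq (c n p).
    by rewrite (bigD1 p)//= lerDl sumr_ge0// => *; exact: csq_ge0.
  apply: (@le_trans _ _ (nrm2 (tsum (c n) (phi n)))); last first.
    have -> : tsum (c n) (phi n) = f + - (f - tsum (c n) (phi n)) by rewrite subKr.
    apply: le_trans (nrm2D_le _ _) _; rewrite nrm2N lerD2l ler_pM2l//.
    apply: (le_trans (ltW (uP n).2)); rewrite lerD2l invf_le1//.
    by rewrite ler1n.
  rewrite /nrm2 ip_tsum.
  apply: le_trans (diagonal_dominance _ M0 _ (gram_le n)); last first.
    by move=> q; rewrite big1// => k _; rewrite ipxx phi1.
  by rewrite ler_pM2l ?subr_gt0.
have [U [UU ooU]] := @ultraFilterLemma nat \oo _.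
have /choice[L cL] p := ultra_bounded_cvgC (UU := UU) (fun n => c_le n p).
have gram1 k n p q : csq (ip (phi n k p) (phi n k q)) <= 1.
  by rewrite (le_trans (cauchy_schwarz _ _))// !phi1 mulr1.
have /choice[G GP] (k : 'I_d) : exists G : 'I_r -> 'I_r -> R[i],
    forall p q, cvgC U (fun n => ip (phi n k p) (phi n k q)) (G p q).
  have /choice[G GP] (pq : 'I_r * 'I_r) :=
    ultra_bounded_cvgC (UU := UU) (fun n => gram1 k n pq.1 pq.2).
  by exists (fun p q => G (p, q)) => p q; exact: (GP (p, q)).
have psi_ex (k : 'I_d) : exists psi : 'I_r -> H k,
    forall p h, cvgC U (fun n => ip h (phi n k p)) (ip h (psi p)).
  suff /choice[psi] : forall p, exists g, forall h, cvgC U (fun n => ip h (phi n k p)) (ip h g).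
    by exists psi.
  move=> p; apply: (@weak_limit _ _ _ U _ _ 1) => n.
  by rewrite phi1.
pose psi k := sval (cid (psi_ex k)).
have psiP k : forall p h, cvgC U (fun n => ip h (phi n k p)) (ip h (psi k p)).
  exact: svalP (cid (psi_ex k)).
have [chi chiG chif] := realize_grams f psiP GP.
have err_cvg : cvgC U (fun n => error_form f (c n) (fun p => ip f (tau (fun k => phi n k p)))
    (fun p q => \prod_k ip (phi n k p) (phi n k q)))
    (error_form f L (fun p => ip f (tau (fun k => chi k p)))
    (fun p q => \prod_k ip (chi k p) (chi k q))).
  apply: cvgCD; [apply: cvgCB; first exact: cvgC_cst|].
    apply: cvgCM; first exact: cvgC_cst.
    apply: cvgC_sum => p; apply: cvgCM; first exact: cvgCJ.
    (* [chi] need not be the weak limit of [phi n]; [chif] exchanges it for [psi], which is. *)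
    rewrite ip_conj chif -ip_conj; apply: tau_weak_cvg => //.
  apply: cvgC_sum => p; apply: cvgC_sum => q; apply: cvgCM.
    by apply: cvgCM => //; exact: cvgCJ.
  by apply: cvgC_prod => k; rewrite chiG.
exists L, chi; split.
  move=> k; split=> [p|p q pq].
    rewrite /nrm2 chiG (_ : G k p p = 1)//; apply: cvgC_unique (GP k p p) _.
    by under eq_fun do rewrite ipxx phi1; exact: cvgC_cst.
  rewrite chiG -(@ler_pXn2r _ 2) ?nnegrE ?cabs_ge0 ?mu0// sqr_cabs.
  apply: cvgC_csq_le (GP k p q) _ => n.
  by rewrite -sqr_cabs ler_pXn2r ?nnegrE ?cabs_ge0 ?mu0// ((uP n).1 k).2.
have err_le : nrm2 (f - tsum L chi) <= inf E.
  have n_cvg : n.+1%:R^-1 @[n --> U] --> (0 : R).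
    by apply: cvg_trans (@cvg_harmonic R); exact: cvg_fmap2.
  have bound_cvg : cvgC U (fun n => (inf E + n.+1%:R^-1)%:C%C) (inf E)%:C%C.
    by split => /=; [rewrite -[X in _ --> X]addr0; apply: cvgD => //|]; exact: cvg_cst.
  rewrite nrm2_error -subr_ge0; have := cvgC_Re_ge0 (cvgCB bound_cvg err_cvg).
  rewrite cReD cReN /=; apply => n; rewrite cReD cReN /= -nrm2_error subr_ge0.
  exact: ltW (uP n).2.
move=> c' phi' phi'P; apply: (le_trans err_le); apply: ge_inf; first exact: hasinf.2.
by exists c', phi'.
Qed.

End TensorApproximation.

(** * The space of square-integrable complex functions *)

Section SquareIntegrable.
Context {R : realType} {disp : measure_display} {T : measurableType disp}.
Context (mu : {measure set T -> \bar R}).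
Implicit Types f g h : T -> R[i].

Lemma measurable_csq f : cmeasurable f -> measurable_fun setT (fun x => csq (f x)).
Proof. by move=> [mr mi]; apply: measurable_funD; exact: measurable_funX. Qed.

Lemma csq_integrable f : L2 mu f -> mu.-integrable setT (EFin \o (fun x => csq (f x))).
Proof.
move=> [mf foo]; apply/integrableP; split.
  exact/measurable_EFinP/measurable_csq.
by under eq_integral do rewrite /= ger0_norm ?csq_ge0//.
Qed.

Lemma cabs_mulJ_le (z w : R[i]) : cabs (z * w^*%C) <= csq z + csq w.
Proof.
rewrite cabsM cabsJ -!sqr_cabs.
have := sqr_ge0 (cabs z - cabs w); have := sqr_ge0 (cabs z + cabs w).
rewrite !expr2; lra.
Qed.

Lemma L2_ReM_integrable f g : L2 mu f -> L2 mu g ->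
  mu.-integrable setT (EFin \o (fun x => Re (f x * (g x)^*%C))).
Proof.
move=> Lf Lg; have [[mrf mif] _] := Lf; have [[mrg mig] _] := Lg.
apply: le_integrable (integrableD measurableT (csq_integrable Lf) (csq_integrable Lg)) => //.
  apply/measurable_EFinP; under eq_fun do rewrite !partE mulrN opprK.
  by apply: measurable_funD; exact: measurable_funM.
move=> x _ /=; rewrite lee_fin [leRHS]ger0_norm ?(addr_ge0 (csq_ge0 _) (csq_ge0 _))//.
exact: le_trans (normRe_le _) (cabs_mulJ_le _ _).
Qed.

Lemma L2_ImM_integrable f g : L2 mu f -> L2 mu g ->
  mu.-integrable setT (EFin \o (fun x => Im (f x * (g x)^*%C))).
Proof.
move=> Lf Lg; have [[mrf mif] _] := Lf; have [[mrg mig] _] := Lg.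
apply: le_integrable (integrableD measurableT (csq_integrable Lf) (csq_integrable Lg)) => //.
  apply/measurable_EFinP; under eq_fun do rewrite !partE mulrN addrC.
  by apply: measurable_funB; exact: measurable_funM.
move=> x _ /=; rewrite lee_fin [leRHS]ger0_norm ?(addr_ge0 (csq_ge0 _) (csq_ge0 _))//.
exact: le_trans (normIm_le _) (cabs_mulJ_le _ _).
Qed.

Lemma cmeasurable_linear (a : R[i]) f g :
  cmeasurable f -> cmeasurable g -> cmeasurable (fun x => a * f x + g x).
Proof.
move=> [mrf mif] [mrg mig].
have mM (c : R) (u : T -> R) : measurable_fun setT u -> measurable_fun setT (fun x => c * u x).
  by move=> mu_; exact: measurable_funM.
split; under eq_fun do rewrite !partE; apply: measurable_funD => //.
  by apply: measurable_funB; exact: mM.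
by apply: measurable_funD; exact: mM.
Qed.

Lemma L2_linear (a : R[i]) f g : L2 mu f -> L2 mu g -> L2 mu (fun x => a * f x + g x).
Proof.
move=> Lf Lg; have mfg := cmeasurable_linear a Lf.1 Lg.1; split => //.
have bnd := integrableD measurableT (integrableZl measurableT (2 * csq a) (csq_integrable Lf))
  (integrableZl measurableT 2 (csq_integrable Lg)).
apply: le_lt_trans (integrable_lty measurableT bnd).
apply: ge0_le_integral => //=.
- by move=> x _; rewrite lee_fin csq_ge0.
- exact/measurable_EFinP/measurable_csq.
- exact: measurable_int bnd.
- move=> x _; rewrite -!EFinM -EFinD lee_fin (le_trans (csqD_le _ _))//.
  by rewrite csqM mulrA.
Qed.

Lemma L2_0 : L2 mu (fun=> 0).
Proof.
split; first by split; exact: measurable_cst.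
by rewrite integral0_eq// => x _; rewrite /csq /= expr0n addr0.
Qed.

Definition L2pred : {pred T -> R[i]} := fun f => `[< L2 mu f >].

Lemma L2pred_submod_closed : submod_closed L2pred.
Proof.
split; first by apply/asboolP; exact: L2_0.
by move=> a f g /asboolP Lf /asboolP Lg; apply/asboolP; exact: L2_linear.
Qed.

HB.instance Definition _ := GRing.isSubmodClosed.Build _ _ L2pred L2pred_submod_closed.

(** Functions rather than classes modulo null sets: operations are pointwise, values at a point make
    sense, and tensors can be formed by multiplying values. *)
Record L2fun := MkL2fun { L2val :> T -> R[i]; _ : L2val \in L2pred }.

HB.instance Definition _ := [isSub for L2val].
HB.instance Definition _ := [Choice of L2fun by <:].
HB.instance Definition _ := [SubChoice_isSubLmodule of L2fun by <:].

Lemma L2funP (f : L2fun) : L2 mu f.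
Proof. by case: f => f Lf; exact/asboolP. Qed.

Definition toL2 f (Lf : L2 mu f) : L2fun := MkL2fun (asboolT Lf).

Lemma cinner_linear (a : R[i]) f g h : L2 mu f -> L2 mu g -> L2 mu h ->
  cinner mu (fun x => a * f x + g x) h = a * cinner mu f h + cinner mu g h.
Proof.
move=> Lf Lg Lh.
have RF := L2_ReM_integrable Lf Lh; have IF := L2_ImM_integrable Lf Lh.
have RG := L2_ReM_integrable Lg Lh; have IG := L2_ImM_integrable Lg Lh.
have ZF (c : R) (u : T -> R) : mu.-integrable setT (EFin \o u) ->
    mu.-integrable setT (EFin \o (fun x => c * u x)).
  by move=> iu; exact: (integrableZl measurableT c iu).
have DF (u v : T -> R) : mu.-integrable setT (EFin \o u) -> mu.-integrable setT (EFin \o v) ->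
    mu.-integrable setT (EFin \o (fun x => u x + v x)).
  by move=> iu iv; exact: (integrableD measurableT iu iv).
apply: complexP; rewrite /cinner !partE /=.
- under eq_Rintegral do rewrite mulrDl cReD -mulrA cReM -mulNr.
  rewrite RintegralD//; last by apply: DF; exact: ZF.
  by rewrite RintegralD; [rewrite !RintegralZl// mulNr|by []|exact: ZF|exact: ZF].
- under eq_Rintegral do rewrite mulrDl cImD -mulrA cImM.
  rewrite RintegralD//; last by apply: DF; exact: ZF.
  by rewrite RintegralD; [rewrite !RintegralZl//|by []|exact: ZF|exact: ZF].
Qed.

Lemma cinner_conj f g : L2 mu f -> L2 mu g -> cinner mu g f = (cinner mu f g)^*%C.
Proof.
move=> Lf Lg; apply: complexP; rewrite /cinner /=.
- by apply: eq_Rintegral => x _; rewrite !partE; ring.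
- rewrite -[RHS]mulN1r -RintegralZl//; last exact: L2_ImM_integrable.
  by apply: eq_Rintegral => x _; rewrite !partE; ring.
Qed.

Lemma cinner_re f : Re (cinner mu f f) = fine (\int[mu]_x (csq (f x))%:E).
Proof.
by rewrite /cinner /=; congr fine; apply: eq_integral => x _; rewrite mulcJ.
Qed.

Lemma cinner_pos f : 0 <= Re (cinner mu f f).
Proof.
by rewrite cinner_re fine_ge0// integral_ge0// => x _; rewrite lee_fin csq_ge0.
Qed.

Lemma L2norm_cinner f : L2norm mu f = Num.sqrt (Re (cinner mu f f)).
Proof. by rewrite cinner_re. Qed.

End SquareIntegrable.

(* [|t| <= 2^n t^2 + 2^-n] with [t = a n.+1 - a n] makes the increments summable. *)
Lemma summable_increments_cvg {R : realType} (a s : nat -> R) (M : R) :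
  (forall n, (a n.+1 - a n) ^+ 2 <= s n) ->
  (forall n, \sum_(0 <= k < n) 2 ^+ k * s k <= M) -> cvgn a.
Proof.
move=> as_ sM; have s0 n : 0 <= s n by rewrite (le_trans _ (as_ n))// sqr_ge0.
have w0 n : 0 <= 2 ^+ n * s n by rewrite mulr_ge0// exprn_ge0.
have csw : cvgn (series (fun n => 2 ^+ n * s n)).
  apply: nondecreasing_is_cvgn; first exact: nondecreasing_series.
  by exists M => _ [n _ <-]; exact: sM.
have csg : cvgn (series (geometric 1 (2^-1 : R))).
  by apply: is_cvg_geometric_series; rewrite ger0_norm; lra.
have cst : cvgn (series (telescope a)).
  apply: normed_cvg.
  apply: (@series_le_cvg _ _ (fun n => 2 ^+ n * s n + geometric 1 2^-1 n)) => [n|n|n|].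
  - exact: normr_ge0.
  - by rewrite addr_ge0// geometric_ge0// invr_ge0.
  - rewrite /telescope /geometric /= mul1r exprVn.
    have p0 : (0 : R) < 2 ^+ n by rewrite exprn_gt0.
    apply: (@le_trans _ _ (2 ^+ n * (a n.+1 - a n) ^+ 2 + (2 ^+ n)^-1)); last first.
      by rewrite lerD2r ler_pM2l.
    rewrite -real_normK ?num_real//; move: `| _ | (normr_ge0 (a n.+1 - a n)) => t t0.
    rewrite -(ler_pM2l p0) mulrDr mulfV ?gt_eqF//.
    have := sqr_ge0 (2 ^+ n * t - 2^-1); rewrite !expr2; lra.
  - by rewrite (_ : series _ = series (fun n => 2 ^+ n * s n) \+ series (geometric 1 2^-1));
      [exact: is_cvgD|apply/funext => n; rewrite /series /= big_split].
rewrite (_ : a = (fun n => a 0%N + series (telescope a) n)).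
  by apply: is_cvgD => //; exact: is_cvg_cst.
by apply/funext => n; rewrite -eq_sum_telescope.
Qed.

(** * Completeness of L^2 *)

Section RieszFischer.
Context {R : realType} {disp : measure_display} {T : measurableType disp}.
Context (mu : {measure set T -> \bar R}).

Lemma integral_csq (f : L2fun mu) : (\int[mu]_x (csq (f x))%:E)%E = (Re (cinner mu f f))%:E.
Proof.
rewrite cinner_re fineK//; apply: integrable_fin_num => //.
exact: csq_integrable (L2funP f).
Qed.

(** Fatou's lemma at fixed [n]: on [A] the functions [csq (u (n + m) x - u n x)] tend to
    [csq (u n x - g x)] as [m] grows, and their integrals stay below the rate. *)
Lemma L2_cvg_cauchy (u : nat -> L2fun mu) (g : T -> R[i]) (A : set T) :
  measurable A -> mu (~` A) = 0%E -> cmeasurable g ->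
  (forall x, A x -> (Re (u n x) @[n --> \oo] --> Re (g x)) /\
                    (Im (u n x) @[n --> \oo] --> Im (g x))) ->
  (forall n m, Re (cinner mu (u (n + m)%N - u n : L2fun mu) (u (n + m)%N - u n : L2fun mu))
     <= 4 * 16^-1 ^+ n) ->
  forall n, (\int[mu]_x (csq (u n x - g x))%:E <= (4 * 16^-1 ^+ n)%:E)%E.
Proof.
move=> mA A0 mg ug uC n.
have mun k : cmeasurable (u k) := (L2funP (u k)).1.
have mB (f h : T -> R[i]) : cmeasurable f -> cmeasurable h ->
    measurable_fun setT (fun x => (csq (f x - h x))%:E).
  move=> mf mh; apply/measurable_EFinP/measurable_csq.
  have := cmeasurable_linear (-1) mh mf.
  by under eq_fun do rewrite mulN1r addrC.
have csq0 (z : R[i]) : (0%:E <= (csq z)%:E)%E by rewrite lee_fin csq_ge0.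
rewrite (ge0_negligible_integral _ _ _ _ A0)//; last 2 first.
- exact: measurableC.
- exact: mB.
rewrite setDE setTI setCK.
pose F m x := (csq (u (n + m)%N x - u n x))%:E.
have FE x : A x -> limn_einf (F^~ x) = (csq (u n x - g x))%:E.
  move=> Ax; have [cr ci] := ug x Ax.
  suff /cvg_limn_einf_sup[] : F m x @[m --> \oo] --> (csq (u n x - g x))%:E by [].
  apply: cvg_EFin; first exact: nearW.
  rewrite -csqN opprB.
  have shift (a : nat -> R) (l : R) : a k @[k --> \oo] --> l -> a (n + k)%N @[k --> \oo] --> l.
    move=> al; rewrite -(cvg_shiftn n) in al.
    by under eq_fun do rewrite addnC.
  have CR := shift _ _ cr; have CI := shift _ _ ci.
  rewrite /F /=; apply: (@cvgC_csq _ _ \oo _ (fun m => u (n + m)%N x - u n x)).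
  by apply: cvgCB; [split|exact: cvgC_cst].
have -> : (\int[mu]_(x in A) (csq (u n x - g x))%:E = \int[mu]_(x in A) limn_einf (F^~ x))%E.
  by apply: eq_integral => x; rewrite inE => Ax; rewrite FE.
apply: le_trans (fatou mu mA _ _) _ => [m|m x _|].
- exact/measurable_funTS/mB.
- exact: csq0.
rewrite limn_einf_lim; apply: lime_le; first exact: is_cvg_einfs.
apply: nearW => k; apply: ereal_inf_le.
exists (\int[mu]_(x in A) F k x)%E; first by exists k => //=.
apply: (@le_trans _ _ (\int[mu]_x F k x)%E).
  apply: ge0_subset_integral => //.
    exact: (mB (u (n + k)%N) (u n)).
  by move=> x _; exact: csq0.
have -> : (\int[mu]_x F k x)%E = _ := integral_csq (u (n + k)%N - u n).
by rewrite lee_fin.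
Qed.

(** Riesz-Fischer. The weighted sum [h] of the squared increments has finite integral, so it is
    finite off a null set, where [summable_increments_cvg] makes [u n x] converge. *)
Lemma L2_complete (u : nat -> L2fun mu) :
  (forall n m, Re (cinner mu (u (n + m)%N - u n : L2fun mu) (u (n + m)%N - u n : L2fun mu))
     <= 4 * 16^-1 ^+ n) ->
  exists g : L2fun mu, forall n,
    Re (cinner mu (u n - g : L2fun mu) (u n - g : L2fun mu)) <= 4 * 16^-1 ^+ n.
Proof.
move=> uC.
have mD k : measurable_fun setT (fun x => csq ((u k.+1 - u k : L2fun mu) x)).
  exact: measurable_csq (L2funP _).1.
pose w k x := (2 ^+ k * csq ((u k.+1 - u k : L2fun mu) x))%:E.
have w0 k x : (0 <= w k x)%E by rewrite lee_fin mulr_ge0 ?csq_ge0// exprn_ge0.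
have mw k : measurable_fun setT (w k).
  by apply/measurable_EFinP; apply: measurable_funM => //; exact: measurable_cst.
pose h x := (\sum_(0 <= k <oo) w k x)%E.
have mh : measurable_fun setT h by exact: ge0_emeasurable_sum.
have h_fin : (\int[mu]_x h x < +oo)%E.
  rewrite integral_nneseries//.
  (* The rate at [m = 1], times the weight [2 ^+ k], leaves the geometric ratio [2 / 16]. *)
  have wk k : (\int[mu]_x w k x <= (4 * 8^-1 ^+ k)%:E)%E.
    rewrite /w; under eq_integral do rewrite EFinM.
    rewrite ge0_integralZl_EFin//; last 2 first.
    - by move=> x _; rewrite lee_fin csq_ge0.
    - exact/measurable_EFinP.
    rewrite integral_csq -EFinM lee_fin; have := uC k 1%N; rewrite addn1 => uk.
    rewrite (le_trans (ler_wpM2l _ uk)) ?exprn_ge0// mulrCA -exprMn.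
    by rewrite (_ : 2 / 16 = 8^-1 :> R)//; field.
  apply: (@le_lt_trans _ _ (\sum_(0 <= k <oo) (4 * 8^-1 ^+ k)%:E)%E).
    by apply: lee_nneseries => [k _ _|k _//]; exact: integral_ge0.
  have cg : series (geometric 4 (8^-1 : R)) @ \oo --> (4 * (1 - 8^-1)^-1 : R).
    by apply: cvg_geometric_series; rewrite ger0_norm; lra.
  have -> : (\sum_(0 <= k <oo) (4 * 8^-1 ^+ k)%:E)%E = (4 * (1 - 8^-1)^-1)%:E :> \bar R.
    apply/cvg_lim => //; under eq_fun do rewrite sumEFin.
    by apply: cvg_EFin => //; exact: nearW.
  exact: ltry.
have h0 x : (0 <= h x)%E by exact: nneseries_ge0.
pose A := [set x | h x \is a fin_num].
have mA : measurable A by rewrite -[A]setTI; exact: emeasurable_fin_num.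
have A0 : mu (~` A) = 0%E.
  have ih : mu.-integrable setT h.
    by apply/integrableP; split => //; under eq_integral do rewrite gee0_abs//.
  have := integrable_ae measurableT ih => -[N [mN N0 subN]].
  apply: (subset_measure0 _ mN _ N0); first exact: measurableC.
  by move=> x Ax; apply: subN => /= /(_ I).
have cA (P : R[i] -> R) : (forall z w, P (z - w) = P z - P w) -> (forall z, P z ^+ 2 <= csq z) ->
    forall x, A x -> cvgn (fun n => P (u n x)).
  move=> PB Pcsq x Ax.
  apply: (@summable_increments_cvg _ _ (fun k => csq ((u k.+1 - u k : L2fun mu) x)) (fine (h x))).
    by move=> n; rewrite -PB Pcsq.
  move=> n; rewrite -lee_fin fineK// -sumEFin.
  by apply: (@nneseries_lim_ge _ (w ^~ x) xpredT 0%N n) => k _ _; exact: w0.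
have ReB (z y : R[i]) : Re (z - y) = Re z - Re y by rewrite !partE.
have ImB (z y : R[i]) : Im (z - y) = Im z - Im y by rewrite !partE.
have cR := cA (@complex.Re R) ReB (fun z => ler_wpDr (sqr_ge0 _) (lexx _)).
have cI := cA (@complex.Im R) ImB (fun z => ler_wpDl (sqr_ge0 _) (lexx _)).
(* Multiplying by [\1_A] makes the sequences converge everywhere, so the limit is measurable on all
   of [T]. *)
pose cut (P : R[i] -> R) x := limn (fun n => P (u n x) * \1_A x).
pose g x : R[i] := (cut (@complex.Re R) x +i* cut (@complex.Im R) x)%C.
have cut_cvg (P : R[i] -> R) : (forall x, A x -> cvgn (fun n => P (u n x))) ->
    forall x, (fun n => P (u n x) * \1_A x) @ \oo --> cut P x.
  move=> cP x; rewrite /cut indicE; have [|] := boolP (x \in A) => xA /=.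
    by under eq_fun do rewrite mulr1; apply: cP; rewrite inE in xA.
  by under eq_fun do rewrite mulr0; exact: is_cvg_cst.
have m1 : measurable_fun setT (\1_A : T -> R) by exact: measurable_indic.
have mg : cmeasurable g.
  split; [apply: measurable_fun_cvg (fun x _ => cut_cvg _ cR x)
         |apply: measurable_fun_cvg (fun x _ => cut_cvg _ cI x)] => n;
  by apply: measurable_funM => //; have [] := (L2funP (u n)).1.
have ug x : A x -> (Re (u n x) @[n --> \oo] --> Re (g x)) /\
                    (Im (u n x) @[n --> \oo] --> Im (g x)).
  move=> Ax; have xA : x \in A by rewrite inE.
  have := cut_cvg _ cR x; have := cut_cvg _ cI x; rewrite /= indicE xA.
  by under eq_fun do rewrite mulr1; move=> ?; under eq_fun do rewrite mulr1.
have bnd := L2_cvg_cauchy mA A0 mg ug uC.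
(* The bound at [n = 0] puts [u 0 - g] in L^2, and [g] is then the difference of two L^2
   functions. *)
have LB : L2 mu (fun x => u 0%N x - g x).
  split; last by rewrite (le_lt_trans (bnd 0%N))// ltry.
  have := cmeasurable_linear (-1) mg (L2funP (u 0%N)).1.
  by under eq_fun do rewrite mulN1r addrC.
have Lg : L2 mu g.
  have := L2_linear (-1) LB (L2funP (u 0%N)).
  by under eq_fun do rewrite mulN1r opprB subrK.
exists (toL2 Lg) => n; rewrite -lee_fin -integral_csq.
exact: bnd.
Qed.

Definition L2space : semiHilbert R.
Proof.
refine (@SemiHilbert R (L2fun mu) (fun f g => cinner mu f g) _ _ _ L2_complete).
- by move=> a f g h; rewrite -cinner_linear//; exact: L2funP.
- by move=> f g; apply: cinner_conj; exact: L2funP.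
- by move=> f; exact: cinner_pos.
Defined.

End RieszFischer.

(** * Integration on the product space *)

Section IntegralTransfer.
Context {R : realType} {d1 d2 : measure_display}
  {X : measurableType d1} {Y : measurableType d2}.
Context (mu : {measure set X -> \bar R}) (P : {measure set Y -> \bar R}).
Context (pi : Y -> X) (mpi : measurable_fun setT pi).
Context (G : Y -> R) (mG : measurable_fun setT G) (G0 : forall y, 0 <= G y).
Context (c : R) (c0 : 0 <= c).
Hypothesis transfer_indic : forall A, measurable A -> (mu A < +oo)%E ->
  (\int[P]_y (\1_A (pi y) * G y)%:E = c%:E * mu A)%E.
Context (h : X -> R) (mh : measurable_fun setT h) (h0 : forall x, 0 <= h x).
Hypothesis h_fin : (\int[mu]_x (h x)%:E < +oo)%E.

Import HBNNSimple.

Lemma integral_transfer_nnsfun (f : {nnsfun X >-> R}) :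
  (forall x, f x <= h x) ->
  (\int[P]_y (f (pi y) * G y)%:E = c%:E * \int[mu]_x (f x)%:E)%E.
Proof.
move=> fh; pose F r y := (r * (\1_(f @^-1` [set r]) (pi y) * G y))%:E.
have mI r : measurable_fun setT (fun y => \1_(f @^-1` [set r]) (pi y) * G y).
  by apply: measurable_funM => //; apply: measurableT_comp => //; exact: measurable_indic.
have F0 r y : (0 <= F r y)%E.
  by rewrite /F mulrA EFinM mule_ge0 ?lee_fin// -lee_fin EFinM nnfun_muleindic_ge0.
have -> : (\int[P]_y (f (pi y) * G y)%:E = \int[P]_y (\sum_(r \in range f) F r y))%E.
  apply: eq_integral => y _; rewrite {1}fimfunE fsumEFin//; congr EFin.
  by rewrite mulr_fsuml; apply: eq_fsbigr => r _; rewrite mulrA.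
rewrite ge0_integral_fsum//; last first.
  by move=> r; apply/measurable_EFinP; apply: measurable_funM => //; exact: measurable_cst.
rewrite integralT_nnsfun sintegralE ge0_mule_fsumr; last first.
  by move=> r; exact: nnsfun_mulemu_ge0.
apply: eq_fsbigr => r; rewrite inE => -[x _ fxr].
have r0 : 0 <= r by rewrite -fxr.
rewrite /F; under eq_integral do rewrite EFinM.
rewrite ge0_integralZl_EFin//; last 2 first.
- by move=> y _; rewrite lee_fin mulr_ge0.
- exact/measurable_EFinP.
have [->|rN0] := eqVneq r 0; first by rewrite !mul0e mule0.
have rgt0 : 0 < r by rewrite lt_neqAle eq_sym rN0.
have mA : measurable (f @^-1` [set r]) by [].
rewrite transfer_indic//; first by rewrite muleCA.
(* A level set of a positive value [r] has finite measure, since [f <= h] and [h] has finite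
   integral; [transfer_indic] asks for that. *)
have : (r%:E * mu (f @^-1` [set r]) < +oo)%E.
  apply: le_lt_trans h_fin.
  have -> : mu (f @^-1` [set r]) = (\int[mu]_z (\1_(f @^-1` [set r]) z)%:E)%E.
    by rewrite integral_indic// setIT.
  rewrite -ge0_integralZl_EFin//.
  - apply: ge0_le_integral => //.
    + by move=> z _; rewrite -EFinM lee_fin mulr_ge0.
    + apply/measurable_EFinP; apply: measurable_funM; first exact: measurable_cst.
      exact: measurable_indic.
    + exact/measurable_EFinP.
    + move=> z _; rewrite -EFinM lee_fin indicE; have [|_] := boolP (z \in _).
        by rewrite inE /= mulr1 => <-.
      by rewrite mulr0.
  - by apply/measurable_EFinP; exact: measurable_indic.
case: (mu _) => [m|//|//]; first by move=> _; rewrite ltry.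
by rewrite gt0_muley ?lte_fin.
Qed.

(** Monotone convergence along simple approximations. It is used with [pi] a coordinate, [G] the
    product of the other factors and [c] the product of their integrals. *)
Lemma integral_transfer :
  (\int[P]_y (h (pi y) * G y)%:E = c%:E * \int[mu]_x (h x)%:E)%E.
Proof.
have mhE : measurable_fun setT (EFin \o h) by exact/measurable_EFinP.
have h0E x : setT x -> (0 <= (EFin \o h) x)%E by move=> _; rewrite lee_fin.
pose f := nnsfun_approx measurableT mhE.
have fh n x : f n x <= h x.
  by rewrite /f nnsfun_approxE -lee_fin; exact: le_approx.
have f_cvg x : f n x @[n --> \oo] --> h x.
  have := cvg_nnsfun_approx measurableT mhE h0E (Logic.I : setT x).
  by move=> /fine_cvgP[].
have f_nd x : nondecreasing_seq (fun n => f n x).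
  by move=> m n mn; exact/lefP/nd_nnsfun_approx.
have mf n : measurable_fun setT (f n) by [].
have cP : (\int[P]_y (f n (pi y) * G y)%:E)%E @[n --> \oo] --> (\int[P]_y (h (pi y) * G y)%:E)%E.
  have -> : (\int[P]_y (h (pi y) * G y)%:E)%E =
      (\int[P]_y limn (fun n => (f n (pi y) * G y)%:E))%E.
    apply: eq_integral => y _; apply/esym/cvg_lim => //; apply: cvg_EFin.
      exact: nearW.
    by apply: cvgM => //; exact: cvg_cst.
  apply: cvg_monotone_convergence => //.
  - move=> n; apply/measurable_EFinP; apply: measurable_funM => //.
    exact: measurableT_comp.
  - by move=> n y _; rewrite lee_fin mulr_ge0.
  - by move=> y _ m n mn; rewrite lee_fin ler_wpM2r//; exact: f_nd.
have cm : (c%:E * \int[mu]_x (f n x)%:E)%E @[n --> \oo] --> (c%:E * \int[mu]_x (h x)%:E)%E.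
  apply: cvgeZl => //.
  have -> : (\int[mu]_x (h x)%:E)%E = (\int[mu]_x limn (fun n => (f n x)%:E))%E.
    apply: eq_integral => x _; apply/esym/cvg_lim => //.
    by apply: cvg_EFin; [exact: nearW|exact: f_cvg].
  apply: cvg_monotone_convergence => //.
  - by move=> n; exact/measurable_EFinP.
  - by move=> n x _; rewrite lee_fin.
  - by move=> x _ m n mn; rewrite lee_fin; exact: f_nd.
rewrite (_ : (fun n => _) = (fun n => c%:E * \int[mu]_x (f n x)%:E)%E) in cP.
  exact: (cvg_unique _ cP cm).
by apply/funext => n; apply: integral_transfer_nnsfun; exact: fh.
Qed.

End IntegralTransfer.

Lemma measurable_fun_prod_seq {R : realType} {d1 : measure_display} {X : measurableType d1}
    (I : Type) (s : seq I) (Q : pred I) (F : I -> X -> R) :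
  (forall i, measurable_fun setT (F i)) ->
  measurable_fun setT (fun x => \prod_(i <- s | Q i) F i x).
Proof.
move=> mF; elim: s => [|i s IH].
  by under eq_fun do rewrite big_nil; exact: measurable_cst.
under eq_fun do rewrite big_cons; case: (Q i) => //.
exact: measurable_funM.
Qed.

Lemma cmeasurable_prod_seq {R : realType} {d1 : measure_display} {X : measurableType d1}
    (I : Type) (s : seq I) (F : I -> X -> R[i]) :
  (forall i, cmeasurable (F i)) -> cmeasurable (fun x => \prod_(i <- s) F i x).
Proof.
move=> mF; elim: s => [|i s [IHr IHi]].
  by split; under eq_fun do rewrite big_nil; exact: measurable_cst.
have [mr mi] := mF i.
split; under eq_fun do rewrite big_cons !partE.
  by apply: measurable_funB; exact: measurable_funM.
by apply: measurable_funD; exact: measurable_funM.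
Qed.

(** Expanding [B] at [a *: x + y] gives [a * B x y + a^*%C * B y x = 0]; the cases [a = 1] and
    [a = 'i] isolate [B x y]. *)
Lemma polarization {R : realType} (V : lmodType R[i]) (B : V -> V -> R[i]) :
  (forall a x y z, B (a *: x + y) z = a * B x z + B y z) ->
  (forall a x y z, B z (a *: x + y) = a^*%C * B z x + B z y) ->
  (forall x, B x x = 0) -> forall x y, B x y = 0.
Proof.
move=> Bl Br B0 x y.
have sum0 a : a * B x y + a^*%C * B y x = 0.
  have := B0 (a *: x + y); rewrite Bl !Br !B0 !(mulr0, add0r, addr0).
  by [].
have h1 := sum0 1; have h2 := sum0 'i%C.
have h : 2 * B x y = 0.
  transitivity ((1 * B x y + 1^*%C * B y x) - 'i%C * ('i%C * B x y + 'i%C^*%C * B y x)).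
    apply: complexP; rewrite !partE /=; ring.
  by rewrite h1 h2 mulr0 subr0.
by move/eqP: h; rewrite mulf_eq0 pnatr_eq0 => /eqP.
Qed.

(** * Tensor products of L^2 functions *)

Section ProductMeasure.
Context {R : realType} {d : nat} {disp : 'I_d -> measure_display}
  (T : forall k : 'I_d, measurableType (disp k)).
Context (mu : forall k : 'I_d, {measure set (T k) -> \bar R})
  (P : {measure set (prodT T) -> \bar R}).
Hypothesis P_prod : is_product_measure mu P.

Lemma measurable_rect (B : forall k, set (T k)) :
  (forall k, measurable (B k)) -> measurable (rect B : set (prodT T)).
Proof. by move=> mB; apply: sub_sigma_algebra; exists B. Qed.

Lemma measurable_coord k : measurable_fun setT (fun x : prodT T => x k).
Proof.
move=> _ B mB; rewrite setTI.
rewrite (_ : _ @^-1` B = rect (dfwith (fun l => [set: T l]) B)).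
  apply: measurable_rect => l; have [->|lk] := eqVneq l k; first by rewrite dfwith_in.
  by rewrite dfwith_out// eq_sym.
apply/seteqP; split => x /= Bx.
  move=> l; have [->|lk] := eqVneq l k; first by rewrite dfwith_in.
  by rewrite dfwith_out// eq_sym.
by have := Bx k; rewrite dfwith_in.
Qed.

Lemma integral_prod_ge0 (g : forall k, T k -> R) :
  (forall k, measurable_fun setT (g k)) -> (forall k x, 0 <= g k x) ->
  (forall k, (\int[mu k]_x (g k x)%:E < +oo)%E) ->
  (\int[P]_x (\prod_k g k (x k))%:E = (\prod_k fine (\int[mu k]_x (g k x)%:E))%:E)%E.
Proof.
(* Indicators are replaced by general functions one coordinate at a time. *)
suff claim (s : seq 'I_d) : forall g : forall k, T k -> R,
  (forall k, measurable_fun setT (g k)) -> (forall k x, 0 <= g k x) ->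
  (forall k, (\int[mu k]_x (g k x)%:E < +oo)%E) ->
  (forall k, k \notin s -> exists2 B, measurable B & g k = \1_B) ->
  (\int[P]_x (\prod_k g k (x k))%:E = (\prod_k fine (\int[mu k]_x (g k x)%:E))%:E)%E.
  by move=> mg g0 gfin; apply: (claim (enum 'I_d)) => // k; rewrite mem_enum.
elim: s => [|k s IH] {}g mg g0 gfin gind.
  pose B k := s2val (cid2 (gind k isT)).
  have mB k : measurable (B k) := s2valP (cid2 (gind k isT)).
  have gB k : g k = \1_(B k) := s2valP' (cid2 (gind k isT)).
  have IB k : (\int[mu k]_x (g k x)%:E = mu k (B k))%E.
    by rewrite gB integral_indic// setIT.
  have Bfin k : mu k (B k) \is a fin_num by rewrite ge0_fin_numE// -IB.
  transitivity (\int[P]_x (\1_(rect B : set (prodT T)) x)%:E)%E.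
    apply: eq_integral => x _; congr EFin.
    rewrite indicE; have [|xB] := boolP (x \in _).
      by rewrite inE => xB; rewrite big1// => k _; rewrite gB indicE mem_set//; exact: xB.
    have [k kB] : exists k, ~ B k (x k).
      by apply/existsNP => xk; move/negP: xB; apply; rewrite inE.
    by rewrite (bigD1 k)//= gB indicE memNset// mul0r.
  rewrite integral_indic//; last exact: measurable_rect.
  rewrite setIT P_prod// (big_morph EFin (@EFinM R) (erefl _)).
  by apply: eq_bigr => k _; rewrite IB fineK.
have Ifin l : (\int[mu l]_x (g l x)%:E)%E \is a fin_num.
  by rewrite ge0_fin_numE ?gfin// integral_ge0// => x _; rewrite lee_fin.
pose G (x : prodT T) := \prod_(l | l != k) g l (x l).
pose c := \prod_(l | l != k) fine (\int[mu l]_x (g l x)%:E)%E.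
have gD1 (h : T k -> R) (x : prodT T) :
    \prod_l dfwith g h l (x l) = h (x k) * G x.
  rewrite (bigD1 k)//= dfwith_in; congr (_ * _); apply: eq_bigr => l lk.
  by rewrite dfwith_out// eq_sym.
have c0 : 0 <= c.
  by apply: prodr_ge0 => l _; rewrite fine_ge0// integral_ge0// => x _; rewrite lee_fin.
have -> : (\int[P]_x (\prod_k g k (x k))%:E = \int[P]_x (g k (x k) * G x)%:E)%E.
  by apply: eq_integral => x _; rewrite (bigD1 k).
rewrite (@integral_transfer _ _ _ _ _ (mu k) P (fun x : prodT T => x k) _ G _ _ c)//.
- rewrite -(fineK (Ifin k)) -EFinM; congr EFin.
  by rewrite mulrC [in RHS](bigD1 k).
- exact: measurable_coord.
- apply: measurable_fun_prod_seq => l.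
  by apply: measurableT_comp => //; exact: measurable_coord.
- by move=> x; apply: prodr_ge0.
- move=> A mA Afin.
  have indE : (\int[mu k]_x (\1_A x)%:E = mu k A)%E by rewrite integral_indic// setIT.
  (* The case of an indicator in coordinate [k] is the induction hypothesis for [g] with [k]-th
     factor [\1_A]. *)
  transitivity (\int[P]_x (\prod_l dfwith g (\1_A : T k -> R) l (x l))%:E)%E.
    by apply: eq_integral => x _; rewrite gD1.
  rewrite IH.
  + rewrite (bigD1 k)//= dfwith_in indE EFinM fineK ?ge0_fin_numE// muleC.
    congr (_%:E * _)%E; apply: eq_bigr => l lk; rewrite dfwith_out// eq_sym//.
  + move=> l; have [->|lk] := eqVneq l k; first by rewrite dfwith_in; exact: measurable_indic.
    by rewrite dfwith_out// eq_sym.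
  + move=> l x; have [lk|lk] := eqVneq l k; first by subst l; rewrite dfwith_in.
    by rewrite dfwith_out// eq_sym.
  + move=> l; have [lk|lk] := eqVneq l k; first by subst l; rewrite dfwith_in indE.
    by rewrite dfwith_out// eq_sym.
  + move=> l ls; have [lk|lk] := eqVneq l k.
      by subst l; rewrite dfwith_in; exists A.
    by rewrite dfwith_out 1?eq_sym//; apply: gind; rewrite inE negb_or lk.
Qed.

Lemma csq_prod (I : Type) (s : seq I) (F : I -> R[i]) :
  csq (\prod_(i <- s) F i) = \prod_(i <- s) csq (F i).
Proof. by apply: (big_morph _ csqM); rewrite csq_real expr1n. Qed.

Lemma integral_csq_tensor (phi : forall k, L2fun (mu k)) :
  (\int[P]_x (csq (\prod_k phi k (x k)))%:E)%E =
  (\prod_k Re (cinner (mu k) (phi k) (phi k)))%:E.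
Proof.
under eq_integral do rewrite csq_prod.
rewrite (@integral_prod_ge0 (fun k x => csq (phi k x))).
- by congr EFin; apply: eq_bigr => k _; rewrite cinner_re.
- by move=> k; exact: measurable_csq (L2funP (phi k)).1.
- by move=> k x; exact: csq_ge0.
- by move=> k; exact: (L2funP (phi k)).2.
Qed.

Lemma L2_tensor (phi : forall k, L2fun (mu k)) :
  L2 P (fun x => \prod_k phi k (x k)).
Proof.
split; last by rewrite integral_csq_tensor ltry.
apply: cmeasurable_prod_seq => k; have [mr mi] := (L2funP (phi k)).1.
by split; [have := mr|have := mi] => m; apply: (measurableT_comp m); exact: measurable_coord.
Qed.

Definition tensor (phi : forall k, L2space (mu k)) : L2space P := toL2 (L2_tensor phi).

Lemma nrm2_tensor phi : nrm2 (tensor phi) = \prod_k nrm2 (phi k).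
Proof.
apply: EFin_inj; rewrite -integral_csq_tensor; apply/esym.
exact: (integral_csq (tensor phi)).
Qed.

Lemma tensor_linear (phi : forall k, L2space (mu k)) k (a : R[i]) (y z : L2space (mu k)) :
  tensor (dfwith phi (a *: y + z)) =
  a *: tensor (dfwith phi y) + tensor (dfwith phi z).
Proof.
apply: val_inj; apply/funext => x /=.
have E (h : L2space (mu k)) :
    \prod_l (dfwith phi h l : L2fun _) (x l) =
    (h : L2fun _) (x k) * \prod_(l | l != k) (phi l : L2fun _) (x l).
  rewrite (bigD1 k)//= dfwith_in; congr (_ * _); apply: eq_bigr => l lk.
  by rewrite dfwith_out// eq_sym.
rewrite E [RHS](_ : _ = a * \prod_l (dfwith phi y l : L2fun _) (x l)
  + \prod_l (dfwith phi z l : L2fun _) (x l))// !E.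
by rewrite -[L2val (a *: y + z) (x k)]/(a * L2val y (x k) + L2val z (x k)); ring.
Qed.

Lemma tensor_ip phi psi : ip (tensor phi) (tensor psi) = \prod_k ip (phi k) (psi k).
Proof.
(* Both sides are sesquilinear in [phi k], [psi k], so polarization reduces the case
   [phi k <> psi k] to the case [phi k = psi k], one coordinate at a time. *)
suff claim (s : seq 'I_d) : forall phi psi, (forall k, k \notin s -> phi k = psi k) ->
    ip (tensor phi) (tensor psi) = \prod_k ip (phi k) (psi k).
  by apply: (claim (enum 'I_d)) => k; rewrite mem_enum.
elim: s => [|k s IH] {}phi {}psi eqs.
  have -> : phi = psi by apply: functional_extensionality_dep => k; exact: eqs.
  rewrite ipxx nrm2_tensor (rmorph_prod (real_complex R)) /=.
  apply: eq_bigr => k _; apply/esym; exact: (@ipxx R (L2space (mu k))).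
pose c := \prod_(l | l != k) ip (phi l) (psi l).
pose B (y z : L2space (mu k)) : R[i] :=
  ip (tensor (dfwith phi y)) (tensor (dfwith psi z)) - ip y z * c.
have B0 : forall y z, B y z = 0.
  apply: polarization => [a x y z|a x y z|x].
  - by rewrite /B tensor_linear !ipE; ring.
  - by rewrite /B tensor_linear !ipE; ring.
  - rewrite /B IH; last first.
      move=> l ls; have [->|lk] := eqVneq l k; first by rewrite !dfwith_in.
      by rewrite !dfwith_out 1?eq_sym// eqs// inE negb_or lk.
    rewrite (bigD1 k)//= !dfwith_in (_ : \prod_(l | _) _ = c) ?subrr//.
    by apply: eq_bigr => l lk; rewrite !dfwith_out// eq_sym.
have dfE (x : forall l, L2space (mu l)) : dfwith x (x k) = x.
  apply: functional_extensionality_dep => l; have [->|lk] := eqVneq l k; first by rewrite dfwith_in.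
  by rewrite dfwith_out// eq_sym.
have := B0 (phi k) (psi k); rewrite /B !dfE => /eqP; rewrite subr_eq0 => /eqP ->.
by rewrite (bigD1 k).
Qed.

End ProductMeasure.

(** * Functions with vanishing integrals over a pi-system *)

Section IntegralOverPiSystem.
Context {R : realType} {d1 : measure_display} {X : measurableType d1}.
Context (mu : {measure set X -> \bar R}).

Section Density.
Context (v : X -> \bar R) (mv : measurable_fun setT v) (v0 : forall x, (0 <= v x)%E).

Definition density (A : set X) : \bar R := (\int[mu]_(x in A) v x)%E.

Let density0 : density set0 = 0%E. Proof. exact: integral_set0. Qed.

Let density_ge0 A : (0 <= density A)%E. Proof. by apply: integral_ge0 => x _. Qed.

Let density_sigma_additive : semi_sigma_additive density.
Proof. exact: semi_sigma_additive_nng_induced. Qed.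

Definition density_measure : {measure set X -> \bar R} :=
  HB.pack density (isMeasure.Build _ _ _ density density0 density_ge0 density_sigma_additive).

End Density.

Lemma pi_system_integral_ae0 (G : set (set X)) (v : X -> R) :
  measurable = <<s G>> -> setI_closed G -> G setT ->
  mu.-integrable setT (EFin \o v) ->
  (forall A, G A -> (\int[mu]_(x in A) (v x)%:E = 0)%E) ->
  ae_eq mu setT (EFin \o v) (cst 0%E).
Proof.
move=> mG GI GT iv v0; set w := EFin \o v.
have mw : measurable_fun setT w := measurable_int _ iv.
have iP := integrable_funepos measurableT iv.
have iN := integrable_funeneg measurableT iv.
pose m1 := density_measure (measurable_funepos mw) (funepos_ge0 w).
pose m2 := density_measure (measurable_funeneg mw) (funeneg_ge0 w).
have GE A : G A -> measurable A by move=> GA; rewrite mG; exact: sub_sigma_algebra.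
have fin1 A : measurable A -> m1 A \is a fin_num.
  by move=> mA; apply: integrable_fin_num => //; exact: integrableS iP.
have fin2 A : measurable A -> m2 A \is a fin_num.
  by move=> mA; apply: integrable_fin_num => //; exact: integrableS iN.
have m12 A : G A -> m1 A = m2 A.
  move=> GA; have mA := GE _ GA; have : (m1 A - m2 A = 0)%E.
    by rewrite -(v0 _ GA) [RHS]integralE.
  by rewrite -(fineK (fin1 _ mA)) -(fineK (fin2 _ mA)) => -[/eqP]; rewrite subr_eq0 => /eqP ->.
have agree A : measurable A -> m1 A = m2 A.
  apply: (measure_unique G (fun=> setT)) => //.
  - by rewrite bigcup_const.
  - by move=> _; rewrite ltey_eq fin1.
apply: integral_ae_eq => //.
move=> A _ mA; rewrite integral0 integralE.
have -> : (\int[mu]_(x in A) w^\+ x)%E = m1 A by [].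
have -> : (\int[mu]_(x in A) w^\- x)%E = m2 A by [].
by rewrite agree// subee// fin2.
Qed.

End IntegralOverPiSystem.

(** * Totality of the elementary tensors *)

Section TensorTotal.
Context {R : realType} {d : nat} {disp : 'I_d -> measure_display}
  (T : forall k : 'I_d, measurableType (disp k)).
Context (mu : forall k : 'I_d, {measure set (T k) -> \bar R})
  (P : {measure set (prodT T) -> \bar R}).
Hypothesis P_prod : is_product_measure mu P.
Hypothesis mu_sfinite : forall k, sigma_finite setT (mu k).
Local Notation tensor := (tensor P_prod).

Lemma L2_indic {d1 : measure_display} {X : measurableType d1}
    (m : {measure set X -> \bar R}) (A : set X) :
  measurable A -> (m A < +oo)%E -> L2 m (fun x => (\1_A x)%:C%C).
Proof.
move=> mA Afin; split.
  by split; [exact: measurable_indic|exact: measurable_cst].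
rewrite (_ : (\int[m]_x _)%E = (\int[m]_x (\1_A x)%:E)%E).
  by rewrite integral_indic// setIT.
apply: eq_integral => x _; rewrite csq_real indicE.
by case: (x \in A); rewrite ?expr1n ?expr0n.
Qed.

Lemma mrects_setI_closed : setI_closed (@mrects _ _ T).
Proof.
move=> _ _ [A mA ->] [B mB ->]; exists (fun k => A k `&` B k) => [k|].
  exact: measurableI.
by apply/seteqP; split => x; [move=> [xA xB] k|move=> xAB; split => k; have [] := xAB k].
Qed.

Lemma mrects_setT : @mrects _ _ T setT.
Proof. by exists (fun=> setT) => //; apply/seteqP; split. Qed.

(** Indicators of the intersections of [B k] and [F k] are in L^2, as [F k] has finite measure.
    Their tensors show that [g] times the indicator of [rect F] has integral 0 over every measurable
    rectangle, and rectangles form a generating pi-system. *)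
Lemma orthogonal_tensor_ae0 (g : L2space P) (F : forall k, set (T k)) :
  (forall phi, ip (tensor phi) g = 0) ->
  (forall k, measurable (F k) /\ (mu k (F k) < +oo)%E) ->
  \forall x \ae P, rect F x -> csq ((g : L2fun P) x) = 0.
Proof.
move=> g_orth FP.
have mF : measurable (rect F : set (prodT T)) by apply: measurable_rect => k; exact: (FP k).1.
have prod_fin (B : forall k, set (T k)) : (forall k, mu k (B k) < +oo)%E ->
    (\prod_k mu k (B k) < +oo)%E.
  move=> Bfin; rewrite -ge0_fin_numE; last by apply: prode_ge0.
  by apply: prode_fin_num => k _; rewrite ge0_fin_numE.
have Ffin : (P (rect F) < +oo)%E.
  by rewrite P_prod; [apply: prod_fin => k; exact: (FP k).2|move=> k; exact: (FP k).1].
have LQ := L2_indic mF Ffin.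
have iRe := L2_ReM_integrable (L2funP g) LQ.
have iIm := L2_ImM_integrable (L2funP g) LQ.
have rect0 A : mrects A ->
    \int[P]_(x in A) Re ((g : L2fun P) x * (\1_(rect F : set (prodT T)) x)%:C%C^*%C) = 0 /\
    \int[P]_(x in A) Im ((g : L2fun P) x * (\1_(rect F : set (prodT T)) x)%:C%C^*%C) = 0.
  move=> [B mB ->].
  have mBF k : measurable (B k `&` F k) by apply: measurableI => //; exact: (FP k).1.
  have BFfin k : (mu k (B k `&` F k) < +oo)%E.
    apply: le_lt_trans (FP k).2; apply: le_measure; rewrite ?inE//; exact: (FP k).1.
  pose phi k : L2space (mu k) := toL2 (L2_indic (mBF k) (BFfin k)).
  have phiE x : (tensor phi : L2fun P) x =
      (\1_(rect B : set (prodT T)) x)%:C%C * (\1_(rect F : set (prodT T)) x)%:C%C.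
    rewrite -rmorphM /= [LHS](_ : _ = \prod_k (\1_(B k `&` F k) (x k))%:C%C)//.
    rewrite -(rmorph_prod (real_complex R)) /=; congr (_%:C%C).
    rewrite !indicE -natrM mulnb -in_setI; have [|xN] := boolP (x \in _ `&` _).
      rewrite inE => -[xB xF]; rewrite big1// => k _.
      by rewrite indicE mem_set.
    have [k kB] : exists k, ~ (B k `&` F k) (x k).
      apply/existsNP => xk; move/negP: xN; apply; rewrite inE; split => k; by have [] := xk k.
    by rewrite (bigD1 k)//= indicE memNset// mul0r.
  pose h (x : prodT T) : R[i] := (\1_(rect B : set (prodT T)) x)%:C%C *
      (\1_(rect F : set (prodT T)) x)%:C%C.
  have gphi : cinner P g h = 0.
    rewrite /h -(funext phiE); have := g_orth phi.
    rewrite ip_conj => /(congr1 conjc); rewrite conjcK conjc0.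
    by [].
  have indB x : (\1_(rect B : set (prodT T)) x)%:C%C =
      (if x \in (rect B : set (prodT T)) then 1 else 0 : R[i]).
    by rewrite indicE; case: (x \in _).
  split; rewrite Rintegral_mkcond.
    transitivity (Re (cinner P g h)); last by rewrite gphi.
    apply: eq_Rintegral => x _; rewrite patchE /h indB; case: ifPn => _; first by rewrite mul1r.
    by rewrite mul0r rmorph0 mulr0.
  transitivity (Im (cinner P g h)); last by rewrite gphi.
  apply: eq_Rintegral => x _; rewrite patchE /h indB; case: ifPn => _; first by rewrite mul1r.
  by rewrite mul0r rmorph0 mulr0.
have ae0 (v : prodT T -> R) : P.-integrable setT (EFin \o v) ->
    (forall A, mrects A -> \int[P]_(x in A) v x = 0) -> ae_eq P setT (EFin \o v) (cst 0%E).
  move=> iv v0; apply: (@pi_system_integral_ae0 _ _ _ P (@mrects _ _ T)) => //.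
  - exact: mrects_setI_closed.
  - exact: mrects_setT.
  - move=> A GA; have mA : measurable (A : set (prodT T)) by exact: sub_sigma_algebra.
    have fin : (\int[P]_(x in A) (v x)%:E)%E \is a fin_num.
      by apply: integrable_fin_num => //; exact: integrableS iv.
    by rewrite -(fineK fin); congr EFin; exact: v0.
have aeR := ae0 _ iRe (fun A GA => (rect0 A GA).1).
have aeI := ae0 _ iIm (fun A GA => (rect0 A GA).2).
apply: filterS2 aeR aeI => x /(_ Logic.I) xR /(_ Logic.I) xI xF.
have F1 : (\1_(rect F : set (prodT T)) x)%:C%C^*%C = 1 :> R[i].
  by rewrite indicE mem_set//; apply: complexP; rewrite ?partE //= oppr0.
move: xR xI; rewrite /comp F1 mulr1 => -[zr] [zi].
by rewrite /csq zr zi expr0n addr0.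
Qed.

Lemma tensor_total (g : L2space P) : (forall phi, ip (tensor phi) g = 0) -> nrm2 g = 0.
Proof.
move=> g_orth.
have FP k : exists F : (set (T k))^nat, [/\ setT = \bigcup_i F i,
    nondecreasing_seq F & forall i, measurable (F i) /\ (mu k (F i) < +oo)%E].
  exact/sigma_finiteP.
pose F k := sval (cid (FP k)).
have F_cover k : setT = \bigcup_i F k i by case: (svalP (cid (FP k))) => + _ _; exact.
have F_nd k : nondecreasing_seq (F k) by case: (svalP (cid (FP k))) => _ + _; exact.
have F_fin k i : measurable (F k i) /\ (mu k (F k i) < +oo)%E.
  by case: (svalP (cid (FP k))) => _ _; exact.
have ae_n n : \forall x \ae P, rect (fun k => F k n) x -> csq ((g : L2fun P) x) = 0.
  by apply: orthogonal_tensor_ae0.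
have ae_all : \forall x \ae P, csq ((g : L2fun P) x) = 0.
  have := ae_foralln ae_n; apply: filterS => x xn.
  have nx k : exists n, F k n (x k).
    by have : (setT : set (T k)) (x k) by []; rewrite (F_cover k) => -[n _ ?]; exists n.
  pose n k := sval (cid (nx k)).
  (* The exhausting sets increase with the index, so the largest of the [n k] works in all
     coordinates. *)
  apply: (xn (\max_k n k)%N) => k.
  have /subsetPset := F_nd k _ _ (leq_bigmax k : (n k <= \max_l n l)%N).
  by apply; exact: svalP (cid (nx k)).
suff : (nrm2 g)%:E = 0%E by move=> [].
rewrite -[(nrm2 g)%:E](integral_csq g).
rewrite (@ge0_ae_eq_integral _ _ _ P setT _ (cst 0%E))//.
- by rewrite integral0.
- exact/measurable_EFinP/measurable_csq/(L2funP g).1.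
- by move=> x _; rewrite lee_fin csq_ge0.
- by apply: filterS ae_all => x -> _.
Qed.

End TensorTotal.

(** * From the Hilbert space problem to admissible functions *)

Lemma bigmax_le_iff {R : realType} (r : nat) (F : 'I_r -> 'I_r -> R) (M : R) :
  0 <= M -> (\big[Num.max/0]_(p < r) \big[Num.max/0]_(q < r | p != q) F p q <= M <->
    forall p q, p != q -> F p q <= M).
Proof.
move=> M0; split.
  move=> /bigmax_leP[_ FM] p q pq.
  by have /bigmax_leP[_] := FM p isT; apply.
by move=> FM; apply/bigmax_leP; split => // p _; apply/bigmax_leP; split => // q; exact: FM.
Qed.

Lemma L2norm_eq1 {R : realType} {dT : measure_display} {X : measurableType dT}
    (m : {measure set X -> \bar R}) (g : L2space m) :
  L2norm m (g : L2fun m) = 1 <-> nrm2 g = 1.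
Proof.
rewrite L2norm_cinner -[Re _]/(nrm2 g); split => [n1|->]; last exact: sqrtr1.
by rewrite -(sqr_sqrtr (nrm2_ge0 g)) n1 expr1n.
Qed.

Section Admissible.
Context {R : realType} {d : nat} {disp : 'I_d -> measure_display}
  (T : forall k : 'I_d, measurableType (disp k)).
Context (mu : forall k : 'I_d, {measure set (T k) -> \bar R})
  (muk : 'I_d -> R) (r : nat).
Hypothesis muk0 : forall k, 0 <= muk k.

Lemma admissible_incoherent (lam : 'I_r -> R[i]) (phi : forall k, 'I_r -> L2space (mu k)) :
  admissible mu muk lam (fun k p => phi k p : L2fun (mu k)) <-> incoherent muk phi.
Proof.
split => H k; have [H1 H2] := H k; split.
- by move=> p; apply/L2norm_eq1; have [] := H1 p.
- exact/(bigmax_le_iff _ (muk0 k)).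
- by move=> p; split; [exact: L2funP|apply/L2norm_eq1; exact: H1].
- exact/(bigmax_le_iff _ (muk0 k)).
Qed.

Lemma admissible_lift (lam : 'I_r -> R[i]) (phi : forall k, 'I_r -> T k -> R[i]) :
  admissible mu muk lam phi ->
  exists psi : forall k, 'I_r -> L2space (mu k), phi = fun k p => L2val (psi k p : L2fun (mu k)).
Proof.
move=> adm; exists (fun k p => toL2 ((adm k).1 p).1).
by apply: functional_extensionality_dep => k; apply/funext => p.
Qed.

End Admissible.

(** The condition is multiplied out, so that it reads [0 < 1] when [r = 1]. Nonemptiness is assumed
    because the constraints can be contradictory, for instance when [muk k = 0] and [r] exceeds the
    dimension of L^2(X_k); no parameters could then attain the infimum. *)
Theorem theorem4 (R : realType) (d : nat) (disp : 'I_d -> measure_display)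
    (T : forall k : 'I_d, measurableType (disp k))
    (mu : forall k : 'I_d, {measure set (T k) -> \bar R})
    (P : {measure set (prodT T) -> \bar R})
    (f : prodT T -> R[i]) (r : nat) (muk : 'I_d -> R) :
  (forall k, sigma_finite setT (mu k)) ->
  is_product_measure mu P ->
  L2 P f ->
  (forall k, 0 <= muk k <= 1) ->
  (r - 1)%N%:R * \prod_(k < d) muk k < 1 ->
  errors mu P f muk r !=set0 ->
  exists (lam : 'I_r -> R[i]) (phi : forall k, 'I_r -> T k -> R[i]),
    admissible mu muk lam phi /\
    L2norm P (fun x => f x - tensor_sum lam phi x) = inf (errors mu P f muk r).
Proof.
move=> mu_sfinite P_prod Lf muk01 muk_lt1 [_ [lam0 [phi0 [adm0 _]]]].
have muk0 k : 0 <= muk k by have /andP[] := muk01 k.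
have [psi0 phi0E] := admissible_lift adm0; rewrite phi0E in adm0.
pose fL : L2space P := toL2 Lf.
have errE lam (phi : forall k, 'I_r -> L2space (mu k)) :
    L2norm P (fun x => f x - tensor_sum lam (fun k p => L2val (phi k p : L2fun (mu k))) x) =
    Num.sqrt (nrm2 (fL - tsum (tensor P_prod) lam phi)).
  have sumE x : L2val (tsum (tensor P_prod) lam phi : L2fun P) x =
      tensor_sum lam (fun k p => L2val (phi k p : L2fun (mu k))) x.
    rewrite /tsum /tensor_sum.
    by elim/big_rec2 : _ => [//|p y z _ <-].
  pose g : L2fun P := fL - tsum (tensor P_prod) lam phi.
  rewrite (_ : (fun x => _) = L2val g); first by rewrite L2norm_cinner.
  by apply/funext => x; rewrite -sumE.
have [lam [phi [phiP best]]] := best_approximation (tensor_ip P_prod)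
  (tensor_total (P_prod := P_prod) mu_sfinite) fL muk0 muk_lt1
  (ex_intro _ psi0 ((admissible_incoherent muk0 lam0 psi0).1 adm0)).
pose phiL k p := L2val (phi k p : L2fun (mu k)).
have adm : admissible mu muk lam phiL by exact/(admissible_incoherent muk0).
exists lam, phiL; split => //.
have minimal e : errors mu P f muk r e ->
    L2norm P (fun x => f x - tensor_sum lam phiL x) <= e.
  move=> [lam' [phi' [adm' ->]]].
  have [psi' phi'E] := admissible_lift adm'; rewrite phi'E in adm' *.
  rewrite !errE ler_wsqrtr//; apply: best.
  exact/(admissible_incoherent muk0 lam').
have attained : errors mu P f muk r (L2norm P (fun x => f x - tensor_sum lam phiL x)).
  by exists lam, phiL.
apply/eqP; rewrite eq_le; apply/andP; split.
  by apply: lb_le_inf => //; exists (L2norm P (fun x => f x - tensor_sum lam phiL x)).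
apply: ge_inf => //.
by exists (L2norm P (fun x => f x - tensor_sum lam phiL x)).
Qed.
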